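(* Let $n\ge1$ and let $a_{i,j},b_{i,j}>0$ ($0\le i\le n-1$, $j\in\mathbb Z$) be weights for which there exist $R>0$, $0<\rho<1$ and $0<\delta_1<\delta_2$ such that, for all $0\le i\le n-1$ and $k\in\mathbb N$, $$\sup_{j\in\mathbb Z}\frac{a_{i,j}a_{i,j+1}\cdots a_{i,j+k-1}}{b_{i,j}b_{i,j+1}\cdots b_{i,j+k-1}}\le R\rho^k,$$ and $\delta_1\le a_{i,j}+b_{i,j}\le\delta_2$ for all $j\in\mathbb Z$, $0\le i\le n-1$. Let $L$ be the lower triangular and $U$ the upper triangular doubly infinite matrix of the LU-decomposition given in the context, let $\Lambda=L^{-1}$ (lower triangular) and $\Upsilon=U^{-1}$ (upper triangular). Then, for $0\le m_1,m_2\le 2n$ and integers $x_1,x_2\ge-1$, the kernel $K=K^{(p)}$ satisfies $$\lim_{p\to\infty}K(m_1,x_1,m_2,x_2)=-\mathbb 1[m_1<m_2]\,(M_{m_1}\cdots M_{m_2-1})(x_1,x_2)+\sum_{\ell=1}^\infty\big(M_{m_1}\cdots M_{2n-1}S^{-n}\Upsilon\big)_{x_1,n-\ell}\,\big(\Lambda M_0\cdots M_{m_2-1}\big)_{n-\ell,x_2}.$$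
   Context: All matrices are indexed by $\mathbb Z\times\mathbb Z$ unless stated otherwise; empty products are the identity. $S$ is the shift, $S_{ij}=1$ if $i=j+1$ and $0$ otherwise; $\Psi=\sum_{k\ge0}S^k$; $D(\mathtt a)$ is the diagonal matrix with entries of $\mathtt a=(\mathtt a_j)_{j\in\mathbb Z}$. Write $\mathtt a_i=(a_{i,j})_j$, $\mathtt b_i=(b_{i,j})_j$. The transition matrices are $M_{2i}=D(\mathtt a_i)+D(\mathtt b_i)S$ and $M_{2i+1}=\Psi$ for $0\le i\le n-1$. Kernel: for $p\ge1$ let $W$ be the $(n+p)\times(n+p)$ matrix $W_{rs}=(M_0M_1\cdots M_{2n-1})(n-r,-s)$, $r,s=1,\dots,n+p$, and $$K(m_1,x_1,m_2,x_2)=-\mathbb 1[m_1<m_2](M_{m_1}\cdots M_{m_2-1})(x_1,x_2)+\sum_{r,s=1}^{n+p}(M_{m_1}\cdots M_{2n-1})(x_1,-s)\,(W^{-1})_{s,r}\,(M_0\cdots M_{m_2-1})(n-r,x_2).$$ This is the Eynard–Mehta correlation kernel of the determinantal point process associated with the non-intersecting paths of the tower Aztec diamond of size $n$ with corridor $p$. LU-decomposition: put $(\mathtt a_i^{(0)},\mathtt b_i^{(0)})=(\mathtt a_i,\mathtt b_i)$ for $0\le i\le n-1$. For $j=1,\dots,n$ and $0\le i\le n-j$, with $k\in\mathbb Z$, let $x^{(j-1)}_{i,k}=a^{(j-1)}_{i,k}+b^{(j-1)}_{i,k}$ for $0\le i\le n-j$ and $x^{(j-1)}_{n-j+1,k}=1$,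 and define $$a^{(j)}_{i,k}=a^{(j-1)}_{i,k}\frac{x^{(j-1)}_{i+1,k}}{x^{(j-1)}_{i,k}},\qquad b^{(j)}_{i,k}=b^{(j-1)}_{i,k-1}\frac{x^{(j-1)}_{i+1,k-1}}{x^{(j-1)}_{i,k-1}}.$$ Let $X_0^{(j)}=D(\mathtt a^{(j)}_0+\mathtt b^{(j)}_0)$ for $0\le j\le n-1$ and $M^{(j)}_{2i}=D(\mathtt a_i^{(j)})+D(\mathtt b_i^{(j)})S$. Then $$L=X_0^{(0)}\Psi X_0^{(1)}\Psi\cdots X_0^{(n-1)}\Psi,\qquad U=M_0^{(n)}M_2^{(n-1)}\cdots M_{2(n-1)}^{(1)}S^{-n},$$ and $M_0M_1\cdots M_{2n-1}S^{-n}=LU$. *)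

(* Defs.v *)
From HB Require Import structures.
From mathcomp Require Import all_boot all_order all_algebra.
From mathcomp Require Import all_classical all_reals all_analysis.

Set Implicit Arguments.
Unset Strict Implicit.
Unset Printing Implicit Defensive.
Import Order.TTheory GRing.Theory Num.Theory.
Import numFieldNormedType.Exports.

Local Open Scope classical_set_scope.
Local Open Scope ring_scope.

(* Matrices indexed by Z x Z. *)
Definition zmx (R : realType) : Type := int -> int -> R.

(* A sum over Z converges when its two one-sided series (indices >= 0 and
   indices <= -1) both converge. *)
Definition zsum_cvg (R : realType) (f : int -> R) : Prop :=
  cvgn (series (fun k : nat => f k%:Z)) /\
  cvgn (series (fun k : nat => f (- k.+1%:Z))).

Definition zsum (R : realType) (f : int -> R) : R :=
  limn (series (fun k : nat => f k%:Z)) +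
  limn (series (fun k : nat => f (- k.+1%:Z))).

Definition zmul (R : realType) (A B : zmx R) : zmx R :=
  fun x y => zsum (fun k => A x k * B k y).

Definition zadd (R : realType) (A B : zmx R) : zmx R :=
  fun x y => A x y + B x y.

Definition zdiag (R : realType) (d : int -> R) : zmx R :=
  fun x y => if x == y then d x else 0.

Definition zid (R : realType) : zmx R := zdiag (fun=> 1).

(* The power S^k of the shift, for any k in Z. *)
Definition zshift (R : realType) (k : int) : zmx R :=
  fun x y => if x == y + k then 1 else 0.

(* The sum of all S^k with k >= 0. *)
Definition Psi (R : realType) : zmx R := fun x y => if y <= x then 1 else 0.

Definition lower_tri (R : realType) (A : zmx R) : Prop :=
  forall x y, x < y -> A x y = 0.

Definition upper_tri (R : realType) (A : zmx R) : Prop :=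
  forall x y, y < x -> A x y = 0.

Definition is_inverse (R : realType) (A B : zmx R) : Prop :=
  zmul A B = zid R /\ zmul B A = zid R.

(* Doubly infinite matrices may have several two-sided inverses; the inverse
   meant is the one that is triangular of the same kind, which is unique. The
   default value 0 is used only if there is none. *)
Definition lower_inv (R : realType) (A : zmx R) : zmx R :=
  xget (fun _ _ => 0 : R) [set B : zmx R | lower_tri B /\ is_inverse A B].

Definition upper_inv (R : realType) (A : zmx R) : zmx R :=
  xget (fun _ _ => 0 : R) [set B : zmx R | upper_tri B /\ is_inverse A B].

(* D(a) + D(b) S *)
Definition bidiag (R : realType) (a b : int -> R) : zmx R :=
  zadd (zdiag a) (zmul (zdiag b) (zshift R 1)).

Section TowerAztec.
Variables (R : realType) (n : nat) (a b : nat -> int -> R).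

Definition transM (m : nat) : zmx R :=
  if odd m then Psi R else bidiag (a m./2) (b m./2).

Definition prodM (m1 m2 : nat) : zmx R :=
  \big[@zmul R/zid R]_(m1 <= m < m2) transM m.

(* Ordinals start at 0: the ordinal r stands for the row index r + 1, and
   likewise s. *)
Definition Wmx (p : nat) : 'M[R]_(n + p) :=
  \matrix_(r < n + p, s < n + p)
    prodM 0 (2 * n) (n%:Z - r.+1%:Z) (- s.+1%:Z).

Definition corr_kernel (p m1 : nat) (x1 : int) (m2 : nat) (x2 : int) : R :=
  - ((m1 < m2)%N%:R * prodM m1 m2 x1 x2) +
  \sum_(r < n + p) \sum_(s < n + p)
    prodM m1 (2 * n) x1 (- s.+1%:Z) * invmx (Wmx p) s r *
    prodM 0 m2 (n%:Z - r.+1%:Z) x2.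

(* The factors x_{i,k} at level j, given the weights at that level. *)
Definition lu_x (j : nat) (c d : nat -> int -> R) (i : nat) (k : int) : R :=
  if (i < n - j)%N then c i k + d i k else 1.

(* The pair (a^(j), b^(j)); only the entries with i <= n - j (and i < n when
   j = 0) are meaningful. *)
Fixpoint lu_weights (j : nat) : (nat -> int -> R) * (nat -> int -> R) :=
  if j is j'.+1 then
    let: (c, d) := lu_weights j' in
    let x := lu_x j' c d in
    (fun i k => c i k * (x i.+1 k / x i k),
     fun i k => d i (k - 1) * (x i.+1 (k - 1) / x i (k - 1)))
  else (a, b).

Definition lu_a (j : nat) : nat -> int -> R := (lu_weights j).1.
Definition lu_b (j : nat) : nat -> int -> R := (lu_weights j).2.

Definition lu_L : zmx R :=
  \big[@zmul R/zid R]_(0 <= j < n)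
    zmul (zdiag (fun k => lu_a j 0 k + lu_b j 0 k)) (Psi R).

Definition lu_U : zmx R :=
  zmul (\big[@zmul R/zid R]_(0 <= i < n)
          bidiag (lu_a (n - i) i) (lu_b (n - i) i))
       (zshift R (- n%:Z)).

Definition Lambda : zmx R := lower_inv lu_L.
Definition Upsilon : zmx R := upper_inv lu_U.

End TowerAztec.

(* Main.v *)
Require Import Defs.
From HB Require Import structures.
From mathcomp Require Import all_boot all_order all_algebra.
From mathcomp Require Import all_classical all_reals all_analysis.
From mathcomp Require Import perm zify ring lra.

Set Implicit Arguments.
Unset Strict Implicit.
Unset Printing Implicit Defensive.
Import Order.TTheory GRing.Theory Num.Theory.
Import numFieldNormedType.Exports.

Local Open Scope classical_set_scope.
Local Open Scope ring_scope.

(** Put T = M_0 M_1 ... M_(2n-1) S^(-n) = L U. The matrix W is the section of T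
    to the window of indices -p, ..., n-1, and every M_m is lower triangular,
    so all products met before inverting U have finite sums as entries. The
    double sum in the kernel is alpha . y, where alpha is row x_1 of
    M_(m_1) ... M_(2n-1) S^(-n) and y solves the finite system W y = g, with g
    the column x_2 of M_0 ... M_(m_2-1). Since x_2 >= -1, g has only finitely
    many nonzero entries in the window, and they do not move as p grows.

    Multiply W y = g by Lambda. This inverse of L is lower triangular and
    banded of width n, because each factor D(x) Psi of L has a bidiagonal
    inverse ([diagPsi_inverse]). Hence on all rows of the window but the n
    lowest ones the truncation is not felt: there U y = Lambda g, and since U is
    upper triangular this determines y = Upsilon Lambda g, independently of p
    ([window_interior]). Only the n lowest unknowns feel the truncation. They
    solve an n x n system with the corner block of T as matrix, and a right-hand
    side made of the neighbouring, already known unknowns.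

    Two estimates finish the proof. Firstly, U is a product of bidiagonal
    matrices whose weights still satisfy a geometric bound on the products of
    ratios a/b ([good_weights_step]), so Upsilon decays like rho^(y - x) up to
    an arbitrarily small loss in the base ([Upsilon_spec]), whereas alpha
    grows slower than any exponential. Secondly, the corner block has a
    determinant bounded below uniformly in p: M_0 ... M_(2n-1) is a product of
    totally nonnegative matrices, and moving n consecutive columns by n steps
    to the left costs at most n^2 factors b, which are bounded below
    ([corner_det_ge]). By Cramer's rule the n lowest unknowns are then of
    exponentially small size ([window_solution_corner]). The same argument with
    g = 0 shows that W is invertible for every p ([Wmx_unit]). So the kernel
    sum is a partial sum of an absolutely convergent series plus a vanishing
    term, and the limit series is the sum over l after a finite
    interchange. *)

(** * Sums over the integers with finite support *)

Section ZSums.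
Variable R : realType.
Implicit Types (f : int -> R) (A B D : zmx R) (x y d e : int).

Definition winsum f (lo : int) (K : nat) : R :=
  \sum_(0 <= l < K) f (lo + l%:Z).

Lemma winsum_widen f lo K lo' K' :
  (forall k, f k != 0 -> lo <= k < lo + K%:Z) ->
  lo' <= lo -> lo + K%:Z <= lo' + K'%:Z ->
  winsum f lo' K' = winsum f lo K.
Proof.
move=> fS le1 le2; rewrite /winsum.
pose i := absz (lo - lo')%R; have iE : lo = lo' + i%:Z by rewrite /i; lia.
rewrite (@big_cat_nat _ _ _ i) //=; last by lia.
rewrite big1_seq ?add0r; last first.
  move=> l /=; rewrite mem_index_iota => /andP[_ li].
  by apply/eqP; apply: contraT => /fS; lia.
rewrite (@big_cat_nat _ _ _ (i + K)%N) //=; [|lia|lia].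
rewrite [X in _ + X]big1_seq ?addr0; last first.
  move=> l /=; rewrite mem_index_iota => /andP[li _].
  by apply/eqP; apply: contraT => /fS; lia.
rewrite -{1}[i]add0n big_addn addKn; apply: eq_bigr => l _.
by congr f; lia.
Qed.

(** Reading a window from its upper end is the indexing of the matrix W, whose
    rows and columns are numbered downwards from n - 1 and -1. *)
Lemma winsum_descending f lo K N : lo + K%:Z = N ->
  winsum f lo K = \sum_(0 <= l < K) f (N - l.+1%:Z).
Proof.
move=> <-; rewrite /winsum big_nat_rev /= !big_nat.
by apply: eq_bigr => l lK; congr f; lia.
Qed.

Lemma winsum_cat f lo K1 K2 :
  winsum f lo (K1 + K2) = winsum f lo K1 + winsum f (lo + K1%:Z) K2.
Proof.
rewrite /winsum (@big_cat_nat _ _ _ K1) //=; last by lia.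
congr (_ + _); rewrite -{1}[K1]add0n big_addn addKn; apply: eq_bigr => l _.
by congr f; lia.
Qed.

Lemma sum_tail (F : nat -> R) p n :
  \sum_(p <= s < n + p) F s = \sum_(0 <= j < n) F (p + j)%N.
Proof.
by rewrite -{1}[p]add0n big_addn addnK; apply: eq_bigr => j _; rewrite addnC.
Qed.

Lemma zsum_finite_support f lo K :
  (forall k, f k != 0 -> lo <= k < lo + K%:Z) ->
  zsum_cvg f /\ zsum f = winsum f lo K.
Proof.
move=> fS.
(* The support lies in the symmetric window from - M to M - 1. *)
pose M := (absz lo + K)%N.
have H1 : \forall m \near \oo,
    series (fun k : nat => f k%:Z) m = winsum f 0 M.
  near=> m; have mM : (M <= m)%N by near: m; exact: nbhs_infty_ge.
  rewrite seriesEnat /= -[m](subnKC mM).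
  under eq_bigr do rewrite -[_%:Z]add0r.
  rewrite -/(winsum f 0 _) winsum_cat [X in _ + X]big1 ?addr0// => l _.
  by apply/eqP; apply: contraT => /fS; rewrite /M; lia.
have H2 : \forall m \near \oo,
    series (fun k : nat => f (- k.+1%:Z)) m = winsum f (- M%:Z) M.
  near=> m; have mM : (M <= m)%N by near: m; exact: nbhs_infty_ge.
  rewrite seriesEnat /=.
  under eq_bigr do rewrite -[- _]add0r.
  rewrite -(@winsum_descending f (- m%:Z)); last by lia.
  rewrite -[in winsum _ _ m](subnK mM) winsum_cat.
  rewrite [X in X + _]big1_seq ?add0r; first by congr winsum; lia.
  move=> l /=; rewrite mem_index_iota => /andP[_ li].
  by apply/eqP; apply: contraT => /fS; rewrite /M; lia.
split.
  by split; [apply: is_cvg_near_cst H1|apply: is_cvg_near_cst H2].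
rewrite /zsum (lim_near_cst _ H1)// (lim_near_cst _ H2)//.
rewrite addrC -[X in winsum f X _ + _ = _]add0r.
have -> : winsum f 0 M = winsum f (- M%:Z + M%:Z) M by congr winsum; lia.
rewrite add0r -winsum_cat; apply: winsum_widen => //; rewrite /M; lia.
Unshelve. all: by end_near.
Qed.

End ZSums.

(** * Triangular matrices up to a shift of the diagonal *)

Section Offset.
Variable R : realType.
Implicit Types (A B D : zmx R) (x y d e g : int).

Definition upper_off d A := forall x y, A x y != 0 -> x + d <= y.
Definition lower_off d A := forall x y, A x y != 0 -> y + d <= x.
Definition ztr A : zmx R := fun x y => A y x.

Lemma zmxP A B : (forall x y, A x y = B x y) -> A = B.
Proof. by move=> AB; apply/funext => x; apply/funext => y. Qed.

Lemma ztrK A : ztr (ztr A) = A.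
Proof. by []. Qed.

Lemma ztr_mul A B : ztr (zmul A B) = zmul (ztr B) (ztr A).
Proof.
apply: zmxP => x y; rewrite /ztr /zmul; congr zsum.
by apply/funext => k; rewrite mulrC.
Qed.

Lemma ztr_id : ztr (zid R) = zid R.
Proof. by apply: zmxP => x y; rewrite /ztr /zid /zdiag eq_sym. Qed.

Lemma upper_off_tr d A : upper_off d (ztr A) <-> lower_off d A.
Proof. by split=> h x y /h. Qed.

Lemma lower_triP A : lower_tri A <-> lower_off 0 A.
Proof.
split=> h x y; first by case: (leP y x) => [|/h ->]; [lia|rewrite eqxx].
by move=> xy; apply/eqP; apply: contraT => /h; lia.
Qed.

Lemma upper_triP A : upper_tri A <-> upper_off 0 A.
Proof.
split=> h x y; first by case: (leP x y) => [|/h ->]; [lia|rewrite eqxx].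
by move=> xy; apply/eqP; apply: contraT => /h; lia.
Qed.

Lemma zmul_upper_window d e A B x y lo K : upper_off d A -> upper_off e B ->
  lo <= x + d -> y - e < lo + K%:Z ->
  zmul A B x y = winsum (fun k => A x k * B k y) lo K.
Proof.
move=> Ad Be le1 le2; apply: (proj2 (zsum_finite_support _)) => k.
by rewrite mulf_eq0 negb_or => /andP[/Ad ? /Be ?]; lia.
Qed.

Lemma zmul_lower_window d e A B x y lo K : lower_off d A -> lower_off e B ->
  lo <= y + e -> x - d < lo + K%:Z ->
  zmul A B x y = winsum (fun k => A x k * B k y) lo K.
Proof.
move=> Ad Be le1 le2; apply: (proj2 (zsum_finite_support _)) => k.
by rewrite mulf_eq0 negb_or => /andP[/Ad ? /Be ?]; lia.
Qed.

(** Offsets add up, so matrices whose nonzero entries lie above some shifted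
    diagonal are closed under products; every such product is a finite sum. *)
Lemma upper_off_mul d e A B :
  upper_off d A -> upper_off e B -> upper_off (d + e) (zmul A B).
Proof.
move=> Ad Be x y; apply: contraR => xy.
rewrite (@zmul_upper_window d e A B x y (x + d) 0) //; [|lia].
by rewrite /winsum big_nil.
Qed.

Lemma lower_off_mul d e A B :
  lower_off d A -> lower_off e B -> lower_off (d + e) (zmul A B).
Proof.
move=> Ad Be; apply/upper_off_tr; rewrite ztr_mul addrC.
by apply: upper_off_mul; apply/upper_off_tr.
Qed.

(** Multiplication of doubly infinite matrices is not associative in general;
    here both iterated sums run over the same finite rectangle. *)
Lemma zmulA_upper d e g A B D :
  upper_off d A -> upper_off e B -> upper_off g D ->
  zmul A (zmul B D) = zmul (zmul A B) D.
Proof.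
move=> Ad Be Dg; apply: zmxP => x y.
have BDeg := upper_off_mul Be Dg; have ABde := upper_off_mul Ad Be.
pose K := (absz (y - x - d - e - g)%R).+1.
rewrite (@zmul_upper_window _ _ _ _ x y (x + d) K Ad BDeg); [|lia|lia].
rewrite (@zmul_upper_window _ _ _ _ x y (x + d + e) K ABde Dg); [|lia|lia].
transitivity (\sum_(0 <= l < K) \sum_(0 <= j < K)
   A x (x + d + l%:Z) * B (x + d + l%:Z) (x + d + e + j%:Z)
     * D (x + d + e + j%:Z) y).
  apply: eq_bigr => l _.
  rewrite (@zmul_upper_window e g B D _ y (x + d + e) K) //; [|lia|lia].
  by rewrite /winsum mulr_sumr; apply: eq_bigr => j _; rewrite mulrA.
rewrite exchange_big /=; rewrite /winsum !big_nat; apply: eq_bigr => j jK.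
rewrite (@zmul_upper_window d e A B x _ (x + d) K) //; [|lia].
by rewrite /winsum mulr_suml.
Qed.

(** Lower triangular facts are transported from upper triangular ones by
    transposition, which exchanges the two factors of a product. *)
Lemma zmulA_lower d e g A B D :
  lower_off d A -> lower_off e B -> lower_off g D ->
  zmul A (zmul B D) = zmul (zmul A B) D.
Proof.
move=> Ad Be Dg; suff E : ztr (zmul A (zmul B D)) = ztr (zmul (zmul A B) D).
  by rewrite -[LHS]ztrK E.
rewrite !ztr_mul; apply/esym; apply: (@zmulA_upper g e d); exact/upper_off_tr.
Qed.

Lemma zmul_diagl c A x y : zmul (zdiag c) A x y = c x * A x y.
Proof.
rewrite /zmul (proj2 (@zsum_finite_support _ _ x 1 _)) => [|k].
  by rewrite /winsum big_nat1 addr0 /zdiag eqxx.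
by rewrite /zdiag; have [->|_] := eqVneq x k; [lia|rewrite mul0r eqxx].
Qed.

Lemma zmul_shiftr A k x y : zmul A (zshift R k) x y = A x (y + k).
Proof.
rewrite /zmul (proj2 (@zsum_finite_support _ _ (y + k) 1 _)) => [|l].
  by rewrite /winsum big_nat1 addr0 /zshift eqxx mulr1.
by rewrite /zshift; have [->|_] := eqVneq l (y + k); [lia|rewrite mulr0 eqxx].
Qed.

Lemma zmul_shiftl A k x y : zmul (zshift R k) A x y = A (x - k) y.
Proof.
rewrite /zmul (proj2 (@zsum_finite_support _ _ (x - k) 1 _)) => [|l].
  by rewrite /winsum big_nat1 addr0 /zshift subrK eqxx mul1r.
by rewrite /zshift; have [->|_] := eqVneq x (l + k); [lia|rewrite mul0r eqxx].
Qed.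

Lemma zmul1l A : zmul (zid R) A = A.
Proof. by apply: zmxP => x y; rewrite zmul_diagl mul1r. Qed.

Lemma zmul1r A : zmul A (zid R) = A.
Proof. by rewrite -[LHS]ztrK ztr_mul ztr_id zmul1l. Qed.

Lemma upper_off_id : upper_off 0 (zid R).
Proof.
move=> x y; rewrite /zid /zdiag.
by have [->|_] := eqVneq x y; [lia|rewrite eqxx].
Qed.

Lemma lower_off_id : lower_off 0 (zid R).
Proof. by apply/upper_off_tr; rewrite ztr_id; exact: upper_off_id. Qed.

Lemma upper_off_shift k : upper_off (- k) (zshift R k).
Proof.
move=> x y; rewrite /zshift.
by have [->|_] := eqVneq x (y + k); [lia|rewrite eqxx].
Qed.

Lemma bidiagE (c d : int -> R) x y :
  bidiag c d x y = if x == y then c x else if x == y + 1 then d x else 0.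
Proof.
rewrite /bidiag /zadd zmul_diagl /zdiag /zshift.
have [->|xy] := eqVneq x y; last by rewrite add0r; case: ifP; rewrite ?mulr0 ?mulr1.
have -> : (y == y + 1) = false by lia.
by rewrite mulr0 addr0.
Qed.

Lemma lower_off_bidiag (c d : int -> R) : lower_off 0 (bidiag c d).
Proof.
move=> x y; rewrite bidiagE; have [->|_] := eqVneq x y; first by lia.
by have [->|_] := eqVneq x (y + 1); [lia|rewrite eqxx].
Qed.

Lemma upper_off_bidiag (c d : int -> R) : upper_off (- 1) (bidiag c d).
Proof.
move=> x y; rewrite bidiagE; have [->|_] := eqVneq x y; first by lia.
by have [->|_] := eqVneq x (y + 1); [lia|rewrite eqxx].
Qed.

Lemma lower_off_Psi : lower_off 0 (Psi R).
Proof. by move=> x y; rewrite /Psi; case: ifP; [lia|rewrite eqxx]. Qed.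

Lemma lower_off_diag c : lower_off 0 (@zdiag R c).
Proof.
move=> x y; rewrite /zdiag.
by have [->|_] := eqVneq x y; [lia|rewrite eqxx].
Qed.

Lemma zmul_bidiagr A (c d : int -> R) x y :
  zmul A (bidiag c d) x y = A x y * c y + A x (y + 1) * d (y + 1).
Proof.
rewrite /zmul (proj2 (@zsum_finite_support _ _ y 2 _)) => [|k].
  rewrite /winsum big_nat_recl // big_nat1 /= addr0 !bidiagE.
  have -> : (y + 1 == y) = false by lia.
  by rewrite !eqxx.
rewrite bidiagE; have [->|_] := eqVneq k y; first by lia.
by have [->|_] := eqVneq k (y + 1); [lia|rewrite mulr0 eqxx].
Qed.

Lemma zmul_bidiagl A (c d : int -> R) x y :
  zmul (bidiag c d) A x y = c x * A x y + d x * A (x - 1) y.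
Proof.
rewrite /zmul (proj2 (@zsum_finite_support _ _ (x - 1) 2 _)) => [|k].
  rewrite /winsum big_nat_recl // big_nat1 /= addr0 !bidiagE subrK.
  have -> : (x == x - 1) = false by lia.
  by rewrite !eqxx addrC.
rewrite bidiagE; have [->|_] := eqVneq x k; first by lia.
by have [->|_] := eqVneq x (k + 1); [lia|rewrite mul0r eqxx].
Qed.

End Offset.

(** * Bounds on the refactored weights *)

Section Weights.
Variable R : realType.
Implicit Types (c d : nat -> int -> R) (q : nat) (k : int).

(** The bounds are uniform over the first q rows of weights: after j sweeps only
    n - j of them are left to be refactored. *)
Definition good_weights (rho : R) q c d := exists m M C : R,
  [/\ 0 < m, 0 < M, 0 < C & forall i k, (i < q)%N ->
    [/\ 0 < c i k <= M, m <= d i k <= M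
      & forall K, \prod_(0 <= l < K) (c i (k + l%:Z) / d i (k + l%:Z))
                   <= C * rho ^+ K]].

(** The case k = 1 of the ratio bound says a <= C rho b; together with
    a + b >= delta1 it keeps b away from 0. *)
Lemma good_weights_base rho (a b : nat -> int -> R) n C delta1 delta2 :
  (forall (i : nat) (j : int), (i < n)%N -> 0 < a i j) ->
  (forall (i : nat) (j : int), (i < n)%N -> 0 < b i j) ->
  0 < C -> 0 < rho -> 0 < delta1 -> delta1 < delta2 ->
  (forall (i k : nat), (i < n)%N ->
      (ereal_sup [set ((\prod_(0 <= l < k) a i (j + l%:Z)) /
                       (\prod_(0 <= l < k) b i (j + l%:Z)))%:E
                  | j in [set: int]]
       <= (C * rho ^+ k)%:E)%E) ->
  (forall (i : nat) (j : int), (i < n)%N ->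
      delta1 <= a i j + b i j <= delta2) ->
  good_weights rho n a b.
Proof.
move=> a0 b0 C0 rho0 d10 d12 ratio sumb.
have ratioP i k K : (i < n)%N ->
    \prod_(0 <= l < K) (a i (k + l%:Z) / b i (k + l%:Z)) <= C * rho ^+ K.
  move=> ilt; rewrite -lee_fin; apply: le_trans (ratio i K ilt).
  by apply: ereal_sup_ubound; exists k => //; rewrite prodf_div.
exists (delta1 / (1 + C * rho)), delta2, C.
have D0 : 0 < 1 + C * rho by rewrite addr_gt0 // mulr_gt0.
split=> //; first by rewrite divr_gt0.
  exact: (lt_trans d10 d12).
move=> i k ilt; have ai := a0 i k ilt; have bi := b0 i k ilt.
have /andP[s1 s2] := sumb i k ilt.
split; [by rewrite ai; lra| |by move=> K; exact: ratioP].
apply/andP; split; last lra.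
rewrite ler_pdivrMr //.
have := ratioP i k 1%N ilt; rewrite big_nat1 addr0 expr1 ler_pdivrMr // => h.
by rewrite mulrDr mulr1 [b i k * _]mulrC; lra.
Qed.

Definition level_sum q c d i k : R := if (i < q)%N then c i k + d i k else 1.

(** One refactorization multiplies c at k by the factor that also turns d at k
    into the new d at k + 1. So the new ratio at k is the old one times the
    quotient of the new d at k + 1 by the new d at k; in a product of ratios
    these quotients telescope and cost at most a constant. *)
Lemma good_weights_step rho q c d (x := level_sum q c d) : 0 < rho ->
  good_weights rho q c d ->
  good_weights rho q (fun i k => c i k * (x i.+1 k / x i k))
     (fun i k => d i (k - 1) * (x i.+1 (k - 1) / x i (k - 1))).
Proof.
move=> rho0 [m [M [C [m0 M0 C0 H]]]].
pose m1 := Num.min m 1; pose M1 := 2 * M + 1.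
have m10 : 0 < m1 by rewrite /m1 lt_min m0 ltr01.
have M10 : 0 < M1 by rewrite /M1; lra.
have xb i k : m1 <= x i k <= M1.
  rewrite /x /level_sum; case: ifP => [iq|_].
    have [/andP[? ?] /andP[? ?] _] := H i k iq.
    apply/andP; split; last by rewrite /M1; lra.
    by apply: le_trans (_ : m1 <= m) _; [rewrite /m1 ge_min lexx|lra].
  by rewrite /m1 /M1 ge_min lexx orbT /=; lra.
have x0 i k : 0 < x i k by have /andP[? _] := xb i k; exact: lt_le_trans m10 _.
have rb i k : m1 / M1 <= x i.+1 k / x i k <= M1 / m1.
  have /andP[? ?] := xb i.+1 k; have /andP[? ?] := xb i k.
  by rewrite !ler_pM ?invr_ge0 ?lef_pV2 ?posrE ?x0 //; apply: ltW.
exists (m * (m1 / M1)), (M * (M1 / m1)), (C * (M * (M1 / m1)) / (m * (m1 / M1))).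
have m'0 : 0 < m * (m1 / M1) by rewrite !mulr_gt0 ?invr_gt0.
have M'0 : 0 < M * (M1 / m1) by rewrite !mulr_gt0 ?invr_gt0.
split=> //; first by rewrite !(mulr_gt0 C0, divr_gt0, mulr_gt0).
pose c' i k := c i k * (x i.+1 k / x i k).
pose d' i k := d i (k - 1) * (x i.+1 (k - 1) / x i (k - 1)).
move=> i k iq.
have cb k' : 0 < c' i k' <= M * (M1 / m1).
  have [/andP[? ?] _ _] := H i k' iq; have /andP[? ?] := rb i k'.
  apply/andP; split; first by rewrite /c' mulr_gt0 // divr_gt0.
  by apply: ler_pM => //; rewrite ltW // divr_gt0.
have db k' : m * (m1 / M1) <= d' i k' <= M * (M1 / m1).
  have [_ /andP[? ?] _] := H i (k' - 1) iq; have /andP[? ?] := rb i (k' - 1).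
  have ? : 0 < d i (k' - 1) by exact: lt_le_trans m0 _.
  have ? : 0 < x i.+1 (k' - 1) / x i (k' - 1) by rewrite divr_gt0.
  by rewrite /d'; apply/andP; split; apply: ler_pM => //; apply: ltW;
    rewrite ?divr_gt0.
have d'0 k' : 0 < d' i k' by have /andP[? _] := db k'; exact: lt_le_trans m'0 _.
split; [exact: cb|exact: db|move=> K; rewrite -/(c' i) -/(d' i)].
have -> : \prod_(0 <= l < K) (c' i (k + l%:Z) / d' i (k + l%:Z))
   = \prod_(0 <= l < K) (c i (k + l%:Z) / d i (k + l%:Z)) * (d' i (k + K%:Z) / d' i k).
  elim: K => [|K IH]; first by rewrite !big_nil addr0 divff ?mulr1 ?gt_eqF.
  rewrite !big_nat_recr //= {}IH.
  have [_ /andP[dm _] _] := H i (k + K%:Z) iq.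
  have dn0 : d i (k + K%:Z) != 0 by rewrite gt_eqF // (lt_le_trans m0 dm).
  have -> : d' i (k + K.+1%:Z) = d i (k + K%:Z) * (x i.+1 (k + K%:Z) / x i (k + K%:Z)).
    by rewrite /d'; have -> : k + K.+1%:Z - 1 = k + K%:Z by lia.
  rewrite /c'; have := d'0 (k + K%:Z); have := d'0 k; move: (d' i _) (d' i _) => u v u0 v0.
  have x1 := x0 i (k + K%:Z).
  by field; rewrite !gt_eqF //=; rewrite lt0r dn0 (le_trans (ltW m0)).
have [_ _ HK] := H i k iq.
rewrite [leRHS](_ : _ = C * rho ^+ K * (M * (M1 / m1) / (m * (m1 / M1)))); last first.
  by rewrite -[in RHS]mulrA [rho ^+ K * _]mulrC !mulrA.
apply: ler_pM => //.
- apply: prodr_ge0 => l _; have [/andP[? _] /andP[? _] _] := H i (k + l%:Z) iq.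
  by rewrite divr_ge0 ?ltW //; exact: lt_le_trans m0 _.
- by rewrite divr_ge0 ?ltW.
- have /andP[h1 h2] := db k; have /andP[h3 h4] := db (k + K%:Z).
  by rewrite ler_pM ?invr_ge0 ?lef_pV2 ?posrE ?d'0 // ltW.
Qed.

Lemma good_weights_le rho q q' c d : (q' <= q)%N ->
  good_weights rho q c d -> good_weights rho q' c d.
Proof.
move=> qq [m [M [C [? ? ? H]]]]; exists m, M, C; split=> // i k iq.
by apply: H; exact: leq_trans qq.
Qed.

Section Lu.
Variables (n : nat) (a b : nat -> int -> R) (rho : R).
Hypotheses (rho0 : 0 < rho) (ab_good : good_weights rho n a b).

Lemma lu_weightsS j : let x := level_sum (n - j) (lu_a n a b j) (lu_b n a b j) in
  lu_a n a b j.+1 = (fun i k => lu_a n a b j i k * (x i.+1 k / x i k)) /\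
  lu_b n a b j.+1 = (fun i k => lu_b n a b j i (k - 1) *
                      (x i.+1 (k - 1) / x i (k - 1))).
Proof. by rewrite /lu_a /lu_b /=; case: (lu_weights n a b j). Qed.

Lemma good_lu_level j : good_weights rho (n - j) (lu_a n a b j) (lu_b n a b j).
Proof.
elim: j => [|j IH]; first by rewrite subn0.
have [-> ->] := lu_weightsS j.
by apply: good_weights_le (good_weights_step rho0 IH); rewrite leq_sub2l.
Qed.

Lemma good_lu_factor i : (i < n)%N ->
  good_weights rho i.+1 (lu_a n a b (n - i)) (lu_b n a b (n - i)).
Proof.
move=> ilt; have -> : (n - i = (n - i.+1).+1)%N by lia.
have [-> ->] := lu_weightsS (n - i.+1).
apply: good_weights_le (good_weights_step rho0 (good_lu_level _)).
by lia.
Qed.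

End Lu.
End Weights.

(** * The factorization and the inverse of its lower factor *)

Section Products.
Variable R : realType.
Implicit Types (A B D : zmx R) (F : nat -> zmx R).

Lemma lower_off0_mul A B :
  lower_off 0 A -> lower_off 0 B -> lower_off 0 (zmul A B).
Proof. by move=> Al Bl; exact: (lower_off_mul Al Bl). Qed.

Lemma zmulA_lower0 A B D : lower_off 0 A -> lower_off 0 B -> lower_off 0 D ->
  zmul A (zmul B D) = zmul (zmul A B) D.
Proof. exact: zmulA_lower. Qed.

Lemma lower_off_big (r : seq nat) F :
  (forall i, i \in r -> lower_off 0 (F i)) ->
  lower_off 0 (\big[@zmul R/zid R]_(i <- r) F i).
Proof.
elim: r => [|i r IH] Fl; first by rewrite big_nil; exact: lower_off_id.
rewrite big_cons; apply: lower_off0_mul.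
  by apply: Fl; rewrite mem_head.
by apply: IH => j jr; apply: Fl; rewrite inE jr orbT.
Qed.

Lemma zbig_cat (r s : seq nat) F : (forall i, lower_off 0 (F i)) ->
  \big[@zmul R/zid R]_(i <- r ++ s) F i =
  zmul (\big[@zmul R/zid R]_(i <- r) F i) (\big[@zmul R/zid R]_(i <- s) F i).
Proof.
move=> Fl; elim: r => [|i r IH]; first by rewrite big_nil zmul1l.
rewrite cat_cons !big_cons IH; apply: (@zmulA_lower _ 0 0 0) => //;
  exact: lower_off_big.
Qed.

(** The products are folded from the right and the ambient multiplication is
    not a monoid law, so splitting off the last factor uses lower
    triangularity. *)
Lemma zbig_nat_recr m1 m2 F : (m1 <= m2)%N -> (forall i, lower_off 0 (F i)) ->
  \big[@zmul R/zid R]_(m1 <= i < m2.+1) F i =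
  zmul (\big[@zmul R/zid R]_(m1 <= i < m2) F i) (F m2).
Proof.
move=> le Fl; rewrite /index_iota subSn // -addn1 iotaD zbig_cat //.
by rewrite subnKC //= big_cons big_nil zmul1r.
Qed.

End Products.

Section Factorization.
Variable R : realType.
Implicit Types (a b c d : nat -> int -> R).

Lemma lower_off_transM a b m : lower_off 0 (transM a b m).
Proof.
by rewrite /transM; case: ifP => _; [exact: lower_off_Psi|exact: lower_off_bidiag].
Qed.

Lemma lower_off_prodM a b m1 m2 : lower_off 0 (prodM a b m1 m2).
Proof. by apply: lower_off_big => i _; exact: lower_off_transM. Qed.

Lemma lower_off_diagPsi (x : int -> R) : lower_off 0 (zmul (zdiag x) (Psi R)).
Proof. exact: (lower_off_mul (@lower_off_diag _ x) (@lower_off_Psi R)). Qed.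

Lemma lower_off_bidiagPsi (c d : int -> R) : lower_off 0 (zmul (bidiag c d) (Psi R)).
Proof. exact: (lower_off_mul (@lower_off_bidiag _ c d) (@lower_off_Psi R)). Qed.

Lemma prodM_pairs a b n :
  prodM a b 0 (2 * n) =
  \big[@zmul R/zid R]_(0 <= i < n) zmul (bidiag (a i) (b i)) (Psi R).
Proof.
elim: n => [|n IH]; first by rewrite muln0 /prodM !big_nil.
rewrite zbig_nat_recr // -?IH; last by move=> i; exact: lower_off_bidiagPsi.
rewrite (_ : 2 * n.+1 = (2 * n).+2)%N; last by lia.
rewrite /prodM !zbig_nat_recr //; try (by move=> i; exact: lower_off_transM).
rewrite -(@zmulA_lower _ 0 0 0); [|exact: lower_off_prodM|exact: lower_off_transM..].
have -> : transM a b (2 * n) = bidiag (a n) (b n).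
  by rewrite /transM mul2n odd_double doubleK.
have -> // : transM a b (2 * n).+1 = Psi R.
by rewrite /transM /= mul2n odd_double.
Qed.

(** The local move behind the factorization: a bidiagonal matrix passes through
    Psi to the right, and the diagonal matrix x' standing there comes out on the left
    as the diagonal matrix of the sums x = c + d. *)
Lemma bidiag_Psi_exchange (c d x x' : int -> R) :
  (forall k, x k = c k + d k) -> (forall k, x k != 0) ->
  zmul (zmul (bidiag c d) (Psi R)) (zdiag x') =
  zmul (zmul (zdiag x) (Psi R))
    (bidiag (fun k => c k * (x' k / x k))
            (fun k => d (k - 1) * (x' (k - 1) / x (k - 1)))).
Proof.
move=> xE x0; apply: zmxP => s t.
rewrite zmul_bidiagr -[LHS]/(ztr (zmul _ _) t s) ztr_mul.
have -> : ztr (zdiag x') = zdiag x'.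
  apply: zmxP => u v; rewrite /ztr /zdiag eq_sym.
  by have [->|] := eqVneq u v.
rewrite zmul_diagl /ztr zmul_bidiagl !zmul_diagl /Psi addrK.
have xt := x0 t; have xs := x0 s; have xEt := xE t; have xEs := xE s.
have [lt_st|lt_ts|<-] := ltgtP s t.
- by rewrite !ifF ?mulr0 ?mul0r ?addr0 ?mulr0 //; lia.
- have -> : (t <= s - 1) = true by lia.
  have -> : (t + 1 <= s) = true by lia.
  by rewrite !mulr1 -xEs -mulrDr -mulrDl -xEt; field.
have -> : (s <= s - 1) = false by lia.
have -> : (s + 1 <= s) = false by lia.
by rewrite !mulr0 mul0r !addr0 !mulr1; field.
Qed.

Lemma exchange_step (G X1 X Y B Z V : zmx R) :
  lower_off 0 G -> lower_off 0 X1 -> lower_off 0 X -> lower_off 0 Y ->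
  lower_off 0 B -> lower_off 0 Z -> lower_off 0 V ->
  zmul G X1 = zmul (zmul X Y) B ->
  zmul G (zmul (zmul X1 Y) (zmul Z V)) =
  zmul (zmul X Y) (zmul (zmul (zmul B Y) Z) V).
Proof.
move=> Gl X1l Xl Yl Bl Zl Vl GX.
have := lower_off0_mul; move=> /(_ R) lm.
rewrite -(@zmulA_lower0 _ X1 Y) ?(@zmulA_lower0 _ G X1) ?GX; try by auto.
rewrite -(@zmulA_lower0 _ (zmul X Y) B); try by auto.
by congr zmul; rewrite (@zmulA_lower0 _ B Y) ?zmulA_lower0; auto.
Qed.

(** Applying the exchange from the last factor, where x' = 1, down to the
    factor i0: each diagonal matrix produced is the one needed at the next
    exchange. The outcome loses one factor Psi on the right. *)
Lemma refactor_sweep q c d c' d' i0 (x := level_sum q c d) :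
  c' = (fun i k => c i k * (x i.+1 k / x i k)) ->
  d' = (fun i k => d i (k - 1) * (x i.+1 (k - 1) / x i (k - 1))) ->
  (i0 < q)%N -> (forall i k, (i < q)%N -> x i k != 0) ->
  \big[@zmul R/zid R]_(i0 <= i < q) zmul (bidiag (c i) (d i)) (Psi R) =
  zmul (zmul (zdiag (x i0)) (Psi R))
    (zmul (\big[@zmul R/zid R]_(i0 <= i < q.-1) zmul (bidiag (c' i) (d' i)) (Psi R))
       (bidiag (c' q.-1) (d' q.-1))).
Proof.
move=> c'E d'E i0q x0.
have exch i : (i < q)%N ->
    zmul (zmul (bidiag (c i) (d i)) (Psi R)) (zdiag (x i.+1)) =
    zmul (zmul (zdiag (x i)) (Psi R)) (bidiag (c' i) (d' i)).
  move=> iq; rewrite c'E d'E; apply: bidiag_Psi_exchange => k; last exact: x0.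
  by rewrite /x /level_sum iq.
have big_low i : lower_off 0 (\big[@zmul R/zid R]_(i <= j < q.-1)
     zmul (bidiag (c' j) (d' j)) (Psi R)).
  by apply: lower_off_big => j _; exact: lower_off_bidiagPsi.
have [m] : exists m, (q = i0 + m.+1)%N by exists (q - i0).-1; lia.
elim: m i0 i0q => [|m IH] i0 i0q qE.
  have qE' : q = i0.+1 by lia.
  have -> : q.-1 = i0 by lia.
  rewrite (@big_geq _ _ _ i0 i0) // zmul1l big_ltn // big_geq; last by lia.
  rewrite zmul1r -exch //.
  have -> : x i0.+1 = fun=> 1.
    by apply/funext => k; rewrite /x /level_sum qE' ltnn.
  by rewrite -/(zid R) zmul1r.
rewrite big_ltn // (IH i0.+1); [|lia|lia].
rewrite (@big_ltn _ _ _ i0 q.-1); last by lia.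
apply: exchange_step.
- exact: lower_off_bidiagPsi.
- exact: lower_off_diag.
- exact: lower_off_diag.
- exact: lower_off_Psi.
- exact: lower_off_bidiag.
- exact: big_low.
- exact: lower_off_bidiag.
- by apply: exch; lia.
Qed.

End Factorization.

Section LU.
Variables (R : realType) (n : nat) (a b : nat -> int -> R) (rho : R).
Hypotheses (rho0 : 0 < rho) (ab_good : good_weights rho n a b).

(** This is U S^n, which is lower triangular as well as upper triangular with
    offset -n. *)
Definition banded_factor : zmx R :=
  \big[@zmul R/zid R]_(0 <= i < n)
     bidiag (lu_a n a b (n - i) i) (lu_b n a b (n - i) i).

Lemma lower_off_banded_factor : lower_off 0 banded_factor.
Proof. by apply: lower_off_big => i _; exact: lower_off_bidiag. Qed.

Lemma lower_off_L : lower_off 0 (lu_L n a b).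
Proof. by apply: lower_off_big => i _; exact: lower_off_diagPsi. Qed.

Lemma level_neq0 j i k : (i < n - j)%N -> lu_a n a b j i k + lu_b n a b j i k != 0.
Proof.
move=> ij; have [m [M [C [m0 _ _ H]]]] := good_lu_level rho0 ab_good j.
have [/andP[? _] /andP[? _] _] := H i k ij.
by rewrite gt_eqF // addr_gt0 //; exact: lt_le_trans m0 _.
Qed.

(** After j sweeps, j factors of L have been collected on the left and j
    finished bidiagonal factors on the right. *)
Lemma lu_partial j : (j <= n)%N ->
  prodM a b 0 (2 * n) =
  zmul (\big[@zmul R/zid R]_(0 <= i < j)
          zmul (zdiag (fun k => lu_a n a b i 0 k + lu_b n a b i 0 k)) (Psi R))
    (zmul (\big[@zmul R/zid R]_(0 <= i < n - j)
            zmul (bidiag (lu_a n a b j i) (lu_b n a b j i)) (Psi R))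
       (\big[@zmul R/zid R]_(n - j <= i < n)
            bidiag (lu_a n a b (n - i) i) (lu_b n a b (n - i) i))).
Proof.
elim: j => [|j IH] jn.
  by rewrite big_geq // zmul1l subn0 (@big_geq _ _ _ n n) // zmul1r prodM_pairs.
rewrite (IH (ltnW jn)) zbig_nat_recr //; last by move=> i; exact: lower_off_diagPsi.
have [aS bS] := lu_weightsS n a b j.
rewrite (refactor_sweep aS bS); [|by rewrite subn_gt0|]; last first.
  by move=> i k ij; rewrite /level_sum ij; exact: level_neq0.
have -> : level_sum (n - j) (lu_a n a b j) (lu_b n a b j) 0 =
          fun k => lu_a n a b j 0 k + lu_b n a b j 0 k.
  by apply/funext => k; rewrite /level_sum subn_gt0 jn.
have -> : ((n - j).-1 = n - j.+1)%N by lia.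
have <- : ((n - j.+1).+1 = n - j)%N by lia.
rewrite (@big_ltn _ _ _ (n - j.+1) n); last by lia.
have -> : (n - (n - j.+1) = j.+1)%N by lia.
set X := zmul (zdiag _) _; set Lp := bigop _ _ _; set Q := bigop _ _ _.
set V := bidiag _ _; set Z := bigop _ _ _.
have Ll : lower_off 0 Lp by apply: lower_off_big => i _; exact: lower_off_diagPsi.
have Xl : lower_off 0 X by exact: lower_off_diagPsi.
have Ql : lower_off 0 Q by apply: lower_off_big => i _; exact: lower_off_bidiagPsi.
have Vl : lower_off 0 V by exact: lower_off_bidiag.
have Zl : lower_off 0 Z by apply: lower_off_big => i _; exact: lower_off_bidiag.
move: Lp X Q V Z Ll Xl Ql Vl Zl => A B D E G Al Bl Dl El Gl.
have DEl := lower_off0_mul Dl El.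
by rewrite (zmulA_lower0 Dl El Gl) -(zmulA_lower0 Bl DEl Gl) (zmulA_lower0 Al Bl (lower_off0_mul DEl Gl)).
Qed.

Lemma lu_factorization : prodM a b 0 (2 * n) = zmul (lu_L n a b) banded_factor.
Proof.
rewrite (lu_partial (leqnn n)) subnn.
by rewrite [X in zmul _ (zmul X _)]big_geq // zmul1l.
Qed.

End LU.

Section Inverse.
Variable R : realType.
Implicit Types (A B : zmx R).

(** A triangular inverse of the same kind is unique because triangular matrices
    multiply associatively. *)
Lemma lower_inv_unique A B : lower_off 0 A -> lower_off 0 B -> is_inverse A B ->
  lower_inv A = B.
Proof.
move=> Al Bl AB; have [B'l [AB' B'A]] : lower_tri (lower_inv A) /\ is_inverse A (lower_inv A).
  apply: (@xgetPex _ _ [set B : zmx R | lower_tri B /\ is_inverse A B]).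
  by exists B; split=> //; apply/lower_triP.
have B'l0 : lower_off 0 (lower_inv A) by exact/lower_triP.
by rewrite -[LHS]zmul1r -AB.1 zmulA_lower0 // B'A zmul1l.
Qed.

Lemma upper_inv_unique A B : upper_off 0 A -> upper_off 0 B -> is_inverse A B ->
  upper_inv A = B.
Proof.
move=> Al Bl AB; have [B'l [AB' B'A]] : upper_tri (upper_inv A) /\ is_inverse A (upper_inv A).
  apply: (@xgetPex _ _ [set B : zmx R | upper_tri B /\ is_inverse A B]).
  by exists B; split=> //; apply/upper_triP.
have B'l0 : upper_off 0 (upper_inv A) by exact/upper_triP.
by rewrite -[LHS]zmul1r -AB.1 (@zmulA_upper _ 0 0 0) // B'A zmul1l.
Qed.

(** The inverse of Psi is 1 - S, so a factor of L has a bidiagonal inverse; this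
    is why the inverse of L is banded. *)
Lemma diagPsi_inverse (x : int -> R) : (forall k, x k != 0) ->
  is_inverse (zmul (zdiag x) (Psi R))
    (bidiag (fun k => (x k)^-1) (fun k => - (x (k - 1))^-1)).
Proof.
move=> x0; split; apply: zmxP => s t.
  rewrite zmul_bidiagr !zmul_diagl /Psi addrK /zid /zdiag.
  have xs := x0 s; have xt := x0 t.
  have [lt_st|lt_ts|<-] := ltgtP s t.
  - have -> : (t + 1 <= s) = false by lia.
    by rewrite !mulr0 !mul0r addr0.
  - have -> : (t + 1 <= s) = true by lia.
    by field.
  have -> : (s + 1 <= s) = false by lia.
  by rewrite ?eqxx; field; rewrite ?xs ?xt.
rewrite zmul_bidiagl !zmul_diagl /Psi /zid /zdiag.
have xs := x0 s; have xt := x0 (s - 1).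
have [lt_st|lt_ts|<-] := ltgtP s t.
- have -> : (t <= s - 1) = false by lia.
  by rewrite !mulr0 addr0.
- have -> : (t <= s - 1) = true by lia.
  by field; rewrite xs xt.
have -> : (s <= s - 1) = false by lia.
by rewrite ?eqxx; field; rewrite ?xs ?xt.
Qed.

Lemma lower_inverse_big (r : seq nat) (F : nat -> zmx R) :
  (forall i, i \in r -> lower_off 0 (F i) /\ exists B,
    [/\ lower_off 0 B, upper_off (- 1) B & is_inverse (F i) B]) ->
  exists B, [/\ lower_off 0 B, upper_off (- (size r)%:Z) B
    & is_inverse (\big[@zmul R/zid R]_(i <- r) F i) B].
Proof.
elim: r => [|i r IH] Fr.
  exists (zid R); split; [exact: lower_off_id|rewrite oppr0; exact: upper_off_id|].
  by rewrite big_nil; split; rewrite zmul1l.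
have [|B [Bl Bu [BI1 BI2]]] := IH; first by move=> j jr; apply: Fr; rewrite inE jr orbT.
have [Fl [G [Gl Gu [GI1 GI2]]]] := Fr i (mem_head _ _).
have bl : lower_off 0 (\big[@zmul R/zid R]_(i <- r) F i).
  by apply: lower_off_big => j jr; apply: (proj1 (Fr j _)); rewrite inE jr orbT.
exists (zmul B G); split; first exact: lower_off0_mul.
  have -> : - (size (i :: r))%:Z = - (size r)%:Z + - 1 by rewrite /=; lia.
  exact: upper_off_mul.
have lm := @lower_off0_mul R.
rewrite big_cons; split.
  by rewrite -zmulA_lower0 ?(@zmulA_lower0 _ _ B G) ?BI1 ?zmul1l //; auto.
by rewrite -zmulA_lower0 ?(@zmulA_lower0 _ G (F i)) ?GI2 ?zmul1l //; auto.
Qed.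

End Inverse.

Section LambdaSpec.
Variables (R : realType) (n : nat) (a b : nat -> int -> R) (rho : R).
Hypotheses (rho0 : 0 < rho) (ab_good : good_weights rho n a b).

Lemma Lambda_spec : [/\ lower_off 0 (Lambda n a b), upper_off (- n%:Z) (Lambda n a b)
  & is_inverse (lu_L n a b) (Lambda n a b)].
Proof.
have [|B [Bl Bu BI]] := @lower_inverse_big R (index_iota 0 n) (fun j =>
    zmul (zdiag (fun k => lu_a n a b j 0 k + lu_b n a b j 0 k)) (Psi R)).
  move=> j; rewrite mem_index_iota => /andP[_ jn]; split; first exact: lower_off_diagPsi.
  eexists; split; last first.
  - by apply: diagPsi_inverse => k; apply: (level_neq0 rho0 ab_good); rewrite subn_gt0.
  - exact: upper_off_bidiag.
  - exact: lower_off_bidiag.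
rewrite size_iota subn0 in Bu.
suff -> : Lambda n a b = B by [].
by apply: lower_inv_unique => //; exact: lower_off_L.
Qed.

Lemma Lambda_prodM : zmul (Lambda n a b) (prodM a b 0 (2 * n)) = banded_factor n a b.
Proof.
have [Ll _ [_ LI]] := Lambda_spec.
rewrite (lu_factorization rho0 ab_good) zmulA_lower0 ?LI ?zmul1l //.
  exact: lower_off_L.
exact: lower_off_banded_factor.
Qed.

End LambdaSpec.

(** * Exponential decay of the inverse of the upper factor *)

Section Decay.
Variable R : realType.
Implicit Types (A B : zmx R) (t : R).

(** The bound is asked for every base above t, rather than for t itself, to make
    the property stable under products. *)
Definition exp_bounded t A := forall th : R, t < th ->
  exists2 C : R, 0 <= C & forall x y, `|A x y| <= C * th ^ (y - x).

(** Each of the k + 1 first terms of the geometric series is at least s^k. *)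
Lemma linear_geometric_le (s : R) k : 0 <= s -> s < 1 ->
  k.+1%:R * s ^+ k <= (1 - s)^-1.
Proof.
move=> s0 s1; have s1' : 0 < 1 - s by rewrite subr_gt0.
rewrite -[leRHS]mul1r ler_pdivlMr //.
have -> : k.+1%:R * s ^+ k * (1 - s) = (1 - s) * \sum_(i < k.+1) s ^+ k.
  by rewrite sumr_const card_ord mulr_natl mulrC.
apply: (@le_trans _ _ ((1 - s) * \sum_(i < k.+1) s ^+ i)).
  rewrite ler_pM2l //; apply: ler_sum => i _.
  by apply: ler_wiXn2l => //; [exact: ltW|rewrite -ltnS].
have -> : (1 - s) * \sum_(i < k.+1) s ^+ i = 1 - s ^+ k.+1.
  by rewrite -opprB mulNr -subrX1 opprB.
by rewrite gerBl exprn_ge0.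
Qed.

(** A product entry is a sum of y - x + const terms of size u^(y - x); the
    linear factor is absorbed by passing from the base u to a larger one. *)
Lemma exp_bounded_mul t d e A B : 0 <= t ->
  upper_off d A -> upper_off e B ->
  exp_bounded t A -> exp_bounded t B -> exp_bounded t (zmul A B).
Proof.
move=> t0 Ad Be hA hB th tth.
pose u := (t + th) / 2.
have tu : t < u by rewrite /u; lra.
have uth : u < th by rewrite /u; lra.
have u0 : 0 < u by exact: le_lt_trans tu.
have th0 : 0 < th by exact: lt_trans uth.
have [C1 C10 H1] := hA u tu; have [C2 C20 H2] := hB u tu.
pose s := u / th.
have s0 : 0 < s by rewrite divr_gt0.
have s1 : s < 1 by rewrite ltr_pdivrMr // mul1r.
have Cge0 : 0 <= C1 * C2 * s ^ (d + e) * (1 - s)^-1.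
  by rewrite !mulr_ge0 // ?exprz_ge0 ?ltW // invr_gt0 subr_gt0.
exists (C1 * C2 * s ^ (d + e) * (1 - s)^-1) => // x y.
have [lt_xy|le_xy] := ltP y (x + (d + e)).
  have -> : zmul A B x y = 0.
    by apply/eqP; apply: contraTT lt_xy => /(upper_off_mul Ad Be); rewrite -leNgt.
  by rewrite normr0 mulr_ge0 // exprz_ge0 // ltW.
pose N := absz (y - x - (d + e))%R.
have NE : y - x = (d + e) + N%:Z.
  by rewrite /N gez0_abs ?subrKC // subr_ge0 lerBrDl.
rewrite (@zmul_upper_window _ d e A B x y (x + d) N.+1) //; last first.
  by move: NE; clear; lia.
apply: (le_trans (ler_norm_sum _ _ _)).
apply: (@le_trans _ _ (\sum_(0 <= l < N.+1) C1 * C2 * u ^ (y - x))).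
  apply: ler_sum => l _; rewrite normrM; set k := x + d + l%:Z.
  apply: le_trans (ler_pM _ _ (H1 x k) (H2 k y)) _ => //.
  rewrite mulrACA -expfzDr ?gt_eqF //.
  have -> : k - x + (y - k) = y - x by rewrite addrC addrA subrK.
  exact: lexx.
rewrite sumr_const_nat subn0 -mulr_natr.
have -> : u ^ (y - x) = s ^ (y - x) * th ^ (y - x).
  by rewrite -expfzMl // divfK // gt_eqF.
rewrite !mulrA -[leRHS]mulrA [_^-1 * _]mulrC mulrA.
have -> : C1 * C2 * s ^ (y - x) * th ^ (y - x) * N.+1%:R =
  C1 * C2 * s ^ (d + e) * th ^ (y - x) * (N.+1%:R * s ^+ N).
  by rewrite {1}NE expfzDr ?gt_eqF // -exprnP; ring.
apply: ler_wpM2l; last by apply: linear_geometric_le => //; exact: ltW.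
by rewrite !mulr_ge0 // exprz_ge0 // ltW.
Qed.

Lemma exp_bounded_id t : 0 <= t -> exp_bounded t (zid R).
Proof.
move=> t0 th tth; have th0 : 0 < th by exact: le_lt_trans tth.
exists 1 => // x y; rewrite mul1r /zid /zdiag; case: eqP => [->|_].
  by rewrite subrr expr0z normr1.
by rewrite normr0 exprz_ge0 // ltW.
Qed.

Lemma exp_bounded_lower_mul t d e A B : 0 <= t ->
  lower_off d A -> lower_off e B ->
  exp_bounded t (ztr A) -> exp_bounded t (ztr B) -> exp_bounded t (ztr (zmul A B)).
Proof.
move=> t0 Al Bl hA hB; rewrite ztr_mul.
by apply: (@exp_bounded_mul t e d) => //; exact/upper_off_tr.
Qed.

Definition exp_inverse t w A := exists B,
  [/\ upper_off w B, exp_bounded t B & is_inverse A B].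

(** The inverse of a factor with offset -1 has offset 1, and the inverses are
    multiplied in the opposite order. *)
Lemma exp_inverse_big t (r : seq nat) (F : nat -> zmx R) : 0 <= t ->
  (forall i, i \in r -> upper_off (- 1) (F i) /\ exp_inverse t 1 (F i)) ->
  upper_off (- (size r)%:Z) (\big[@zmul R/zid R]_(i <- r) F i) /\
  exp_inverse t (size r)%:Z (\big[@zmul R/zid R]_(i <- r) F i).
Proof.
move=> t0; elim: r => [|i r IH] Fr.
  rewrite big_nil oppr0; split; first exact: upper_off_id.
  exists (zid R); split; [exact: upper_off_id|exact: exp_bounded_id|].
  by split; rewrite zmul1l.
have [|bu [B [Bu Be [BI1 BI2]]]] := IH.
  by move=> j jr; apply: Fr; rewrite inE jr orbT.
have [Fu [G [Gu Ge [GI1 GI2]]]] := Fr i (mem_head _ _).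
have sE : (size (i :: r))%:Z = (size r)%:Z + 1 by clear; rewrite /=; lia.
rewrite big_cons sE; split.
  rewrite (_ : - _ = - 1 + - (size r)%:Z); last by clear; lia.
  exact: upper_off_mul.
move: (bigop _ _ _) bu BI1 BI2 => Z Zu BI1 BI2.
have BGu := upper_off_mul Bu Gu; have FZu := upper_off_mul Fu Zu.
exists (zmul B G); split=> //; first exact: (exp_bounded_mul t0 Bu Gu).
split.
  by rewrite -(zmulA_upper Fu Zu BGu) (zmulA_upper Zu Bu Gu) BI1 zmul1l.
by rewrite -(zmulA_upper Bu Gu FZu) (zmulA_upper Gu Fu Zu) GI2 zmul1l.
Qed.

End Decay.

Section BidiagInverse.
Variable R : realType.
Variables (c d : int -> R) (rho m C : R).
Hypotheses (rho0 : 0 < rho) (m0 : 0 < m) (C0 : 0 < C).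
Hypotheses (c_ge0 : forall k, 0 <= c k) (d_ge : forall k, m <= d k).
Hypothesis ratio : forall k K,
  \prod_(0 <= l < K) (c (k + l%:Z) / d (k + l%:Z)) <= C * rho ^+ K.

(** Expansion of (D(c) + D(d) S)^(-1) as the Neumann series in D(c) S^(-1): it has
    only nonzero entries strictly above the diagonal. *)
Definition bidiag_inv : zmx R := fun x y =>
  if x < y then
    (- 1) ^+ absz (y - x - 1)%R *
    \prod_(0 <= l < absz (y - x - 1)%R) (c (x + 1 + l%:Z) / d (x + 1 + l%:Z)) / d y
  else 0.

Let d0 k : 0 < d k.
Proof. exact: lt_le_trans m0 _. Qed.

Lemma upper_off_bidiag_inv : upper_off 1 bidiag_inv.
Proof. by move=> x y; rewrite /bidiag_inv; case: ifP; [lia|rewrite eqxx]. Qed.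

Lemma exp_bounded_bidiag_inv : exp_bounded rho bidiag_inv.
Proof.
move=> th rth; have th0 : 0 < th by exact: lt_trans rth.
exists (C / m / th) => [|x y]; first by rewrite !divr_ge0 // ltW.
rewrite /bidiag_inv; case: ifP => [xy|_]; last first.
  by rewrite normr0 mulr_ge0 ?exprz_ge0 // ?divr_ge0 // ltW.
set N := absz _; have NE : y - x = N%:Z + 1 by rewrite /N; clear -xy; lia.
have P0 : 0 <= \prod_(0 <= l < N) (c (x + 1 + l%:Z) / d (x + 1 + l%:Z)).
  by apply: prodr_ge0 => l _; rewrite divr_ge0 // ltW.
rewrite !normrM normrX normrN1 expr1n mul1r ger0_norm // normfV gtr0_norm //.
rewrite NE expfzDr ?gt_eqF // expr1z -exprnP.
have -> : C / m / th * (th ^+ N * th) = C * th ^+ N / m.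
  by field; rewrite !gt_eqF.
apply: ler_pM => //; first by rewrite invr_ge0 ltW.
  apply: le_trans (ratio _ _) _; rewrite ler_pM2l //.
  by apply: lerXn2r; rewrite ?nnegrE ltW.
by rewrite lef_pV2 ?posrE.
Qed.

Lemma bidiag_invP : is_inverse (bidiag c d) bidiag_inv.
Proof.
split; apply: zmxP => x y.
  rewrite zmul_bidiagl /bidiag_inv /zid /zdiag.
  have dx := d0 x; have [xy|yx|<-] := ltgtP x y.
  - have -> : (x - 1 < y) = true by clear -xy; lia.
    have -> : absz (y - (x - 1) - 1)%R = (absz (y - x - 1)%R).+1 by clear -xy; lia.
    rewrite big_nat_recl // subrK addr0 exprS.
    have -> : forall K, \prod_(0 <= l < K) (c (x + l.+1%:Z) / d (x + l.+1%:Z)) =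
        \prod_(0 <= l < K) (c (x + 1 + l%:Z) / d (x + 1 + l%:Z)).
      by move=> K; apply: eq_bigr => l _; rewrite -addrA -PoszD add1n.
    have dy := d0 y.
    by field; rewrite !gt_eqF.
  - have -> : (x - 1 < y) = false by clear -yx; lia.
    by rewrite !mulr0 addr0.
  have -> : (x - 1 < x) = true by clear; lia.
  have -> : absz (x - (x - 1) - 1)%R = 0%N by clear; lia.
  by rewrite big_nil; field; rewrite gt_eqF.
rewrite zmul_bidiagr /bidiag_inv /zid /zdiag.
have dy1 := d0 (y + 1); have [xy|yx|<-] := ltgtP x y.
- have -> : (x < y + 1) = true by clear -xy; lia.
  have -> : absz (y + 1 - x - 1)%R = (absz (y - x - 1)%R).+1 by clear -xy; lia.
  rewrite big_nat_recr //= exprS.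
  have -> : x + 1 + (absz (y - x - 1)%R)%:Z = y by clear -xy; lia.
  have dy := d0 y.
  by field; rewrite !gt_eqF.
- have -> : (x < y + 1) = false by clear -yx; lia.
  by rewrite !mul0r addr0.
have -> : (x < x + 1) = true by clear; lia.
have -> : absz (x + 1 - x - 1)%R = 0%N by clear; lia.
by rewrite big_nil; field; rewrite gt_eqF.
Qed.

End BidiagInverse.

Section UpsilonSpec.
Variables (R : realType) (n : nat) (a b : nat -> int -> R) (rho : R).
Hypotheses (rho0 : 0 < rho) (ab_good : good_weights rho n a b).

(** U = N S^(-n) with N a product of n bidiagonal factors; its inverse is S^n
    times the product of their inverses, and the two offsets n cancel. *)
Lemma Upsilon_spec : [/\ upper_off 0 (lu_U n a b), upper_off 0 (Upsilon n a b),
  exp_bounded rho (Upsilon n a b) & is_inverse (lu_U n a b) (Upsilon n a b)].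
Proof.
have [|Nu [B [Bu Be [BI1 BI2]]]] := @exp_inverse_big R rho (index_iota 0 n)
    (fun i => bidiag (lu_a n a b (n - i) i) (lu_b n a b (n - i) i)) (ltW rho0).
  move=> i; rewrite mem_index_iota => /andP[_ ilt]; split; first exact: upper_off_bidiag.
  have [m [M [C [m0 M0 C0 H]]]] := good_lu_factor rho0 ab_good ilt.
  have c0 k : 0 <= lu_a n a b (n - i) i k.
    by have [/andP[/ltW]] := H i k (ltnSn i).
  have d0 k : m <= lu_b n a b (n - i) i k.
    by have [_ /andP[]] := H i k (ltnSn i).
  have r k K := let: And3 _ _ h := H i k (ltnSn i) in h K.
  exists (bidiag_inv (lu_a n a b (n - i) i) (lu_b n a b (n - i) i)); split.
  - exact: upper_off_bidiag_inv.
  - exact: (exp_bounded_bidiag_inv rho0 m0 C0 c0 d0 r).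
  - exact: (bidiag_invP _ m0 d0).
rewrite size_iota subn0 in Nu Bu; rewrite -/(banded_factor n a b) in Nu BI1 BI2.
pose V := zmul (zshift R n%:Z) B.
have VE x y : V x y = B (x - n%:Z) y by rewrite /V zmul_shiftl.
have Vu : upper_off 0 V by move=> x y; rewrite VE => /Bu; rewrite subrK addr0.
have Sn := @upper_off_shift R n%:Z; have Sm := @upper_off_shift R (- n%:Z).
have Uu : upper_off 0 (lu_U n a b).
  by move=> x y; rewrite /lu_U zmul_shiftr => /Nu; rewrite lerD2r addr0.
suff VI : is_inverse (lu_U n a b) V.
  have -> : Upsilon n a b = V by exact: upper_inv_unique.
  split=> // th rth; have [C C0 H] := Be th rth.
  have th0 : 0 < th by exact: lt_trans rth.
  exists (C * th ^ n%:Z) => [|x y]; first by rewrite mulr_ge0 // exprz_ge0 // ltW.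
  apply: le_trans (_ : C * th ^ (y - (x - n%:Z)) <= _); first by rewrite VE.
  by rewrite -mulrA -expfzDr ?gt_eqF // opprB addrCA.
split.
  rewrite /lu_U -/(banded_factor n a b) -(zmulA_upper Nu Sm Vu) -[RHS]BI1; congr zmul.
  by apply: zmxP => x y; rewrite zmul_shiftl VE opprK addrK.
have NSu := upper_off_mul Nu Sm.
rewrite /lu_U -/(banded_factor n a b) -(zmulA_upper Sn Bu NSu) (zmulA_upper Bu Nu Sm) BI2 zmul1l.
apply: zmxP => x y; rewrite zmul_shiftl /zshift /zid /zdiag.
by rewrite (can_eq (addrK _)).
Qed.

End UpsilonSpec.

Section Growth.
Variables (R : realType) (n : nat) (a b : nat -> int -> R) (M : R).
Hypotheses (M0 : 0 < M) (ab_le : forall i k, (i < n)%N ->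
  0 <= a i k <= M /\ 0 <= b i k <= M).

Lemma exp_bounded_transM m : (m < 2 * n)%N -> exp_bounded 1 (ztr (transM a b m)).
Proof.
move=> mn th th1; have th0 : 0 < th by exact: lt_trans th1.
have pow_ge1 K : 1 <= th ^ K%:Z by rewrite -exprnP exprn_ege1 // ltW.
rewrite /transM; case: ifP => _.
  exists 1 => // x y; rewrite mul1r /ztr /Psi; case: ifP => xy; last first.
    by rewrite normr0 exprz_ge0 // ltW.
  by rewrite normr1; have -> : y - x = (absz (y - x)%R)%:Z by rewrite gez0_abs ?subr_ge0.
have hn : (m./2 < n)%N by rewrite ltn_half_double -mul2n.
exists M => [|x y]; first exact: ltW.
rewrite /ztr bidiagE.
have [/andP[? ?] /andP[? ?]] := ab_le y hn.
have [<-|_] := eqVneq y x; first by rewrite subrr expr0z mulr1 ger0_norm.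
have [E|_] := eqVneq y (x + 1); last by rewrite normr0 mulr_ge0 ?exprz_ge0 ?ltW.
have -> : y - x = 1 by rewrite E addrC addKr.
rewrite ger0_norm // expr1z; apply: (@le_trans _ _ (M * 1)); first by rewrite mulr1.
by rewrite ler_pM2l // ltW.
Qed.

Lemma exp_bounded_prodM m1 m2 : (m2 <= 2 * n)%N ->
  exp_bounded 1 (ztr (prodM a b m1 m2)).
Proof.
move=> m2n; rewrite /prodM.
have : forall m, m \in index_iota m1 m2 -> (m < 2 * n)%N.
  by move=> m; rewrite mem_index_iota => /andP[_ /leq_trans]; apply.
elim: (index_iota m1 m2) => [|m r IH] mr.
  by rewrite big_nil ztr_id; exact: exp_bounded_id.
rewrite big_cons; apply: (@exp_bounded_lower_mul _ _ 0 0) => //.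
- exact: lower_off_transM.
- by apply: lower_off_big => i _; exact: lower_off_transM.
- by apply: exp_bounded_transM; apply: mr; rewrite mem_head.
- by apply: IH => i ir; apply: mr; rewrite inE ir orbT.
Qed.

End Growth.

(** * Total nonnegativity and the corner determinant *)

Section Minors.
Variables (R : realType) (n : nat).
Implicit Types (A B : int -> 'I_n -> R) (g : 'I_n -> int).

(** Columns of a matrix with n rows are indexed by the integers, and the
    selected columns are laid out as the rows of the square matrix. *)
Definition minor A g : R := \det (\matrix_(i, j) A (g i) j).
Definition increasing g := forall i j : 'I_n, (i < j)%N -> g i < g j.
Definition minors_ge0 A := forall g, increasing g -> 0 <= minor A g.

Lemma eq_minor A B g g' : (forall i j, A (g i) j = B (g' i) j) ->
  minor A g = minor B g'.
Proof. by move=> AB; congr determinant; apply/matrixP => i j; rewrite !mxE. Qed.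

(** The determinant is multilinear: choose in each selected column y either the
    term of A at y or the one at y + 1. *)
Lemma minor_expand A B (al be : int -> R) g :
  (forall y j, B y j = al y * A y j + be y * A (y + 1) j) ->
  minor B g = \sum_(h : {ffun 'I_n -> bool})
    (\prod_i (if h i then be (g i) else al (g i))) *
    minor A (fun i => g i + (nat_of_bool (h i))%:Z).
Proof.
move=> BE; rewrite /minor /determinant.
under [RHS]eq_bigr do rewrite mulr_sumr.
rewrite exchange_big; apply: eq_bigr => s _ /=.
have -> : \prod_(i < n) (\matrix_(i, j) B (g i) j) i (s i) =
    \prod_(i < n) \sum_(t : bool) (if t then be (g i) else al (g i)) *
                A (g i + (nat_of_bool t)%:Z) (s i).
  by apply: eq_bigr => i _; rewrite mxE BE big_bool /= addr0 addrC.
rewrite bigA_distr_bigA mulr_sumr /=; apply: eq_bigr => h _.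
rewrite big_split /= mulrCA; congr (_ * (_ * _)).
by apply: eq_bigr => i _; rewrite mxE.
Qed.

(** Moving some indices of an increasing sequence by one keeps it increasing,
    unless two indices collide; then two rows agree. *)
Lemma minor_shift_ge0 A g (h : 'I_n -> bool) : minors_ge0 A -> increasing g ->
  0 <= minor A (fun i => g i + (nat_of_bool (h i))%:Z).
Proof.
move=> A0 gi; set g' := fun i => _.
have [gi'|] := pselect (increasing g'); first exact: A0.
move=> /existsNP[i] /existsNP[j] /not_implyP[ij /negP]; rewrite -leNgt => le.
have gij := gi i j ij.
have E : g' i = g' j.
  apply/eqP; rewrite eq_le le andbT; move: gij; rewrite /g'; clear.
  by case: (h i); case: (h j) => /=; lia.
rewrite /minor (@determinant_alternate _ _ _ i j) //; first by rewrite neq_ltn ij.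
by move=> k; rewrite !mxE E.
Qed.

(** All terms of the expansion are nonnegative, so a minor is at least the term
    in which no column moves, and at least the one in which all columns do. *)
Lemma minor_step A B (al be : int -> R) :
  (forall y, 0 <= al y) -> (forall y, 0 <= be y) ->
  (forall y j, B y j = al y * A y j + be y * A (y + 1) j) ->
  minors_ge0 A -> forall g, increasing g ->
  (\prod_i al (g i)) * minor A g <= minor B g /\
  (\prod_i be (g i)) * minor A (fun i => g i + 1) <= minor B g.
Proof.
move=> al0 be0 BE A0 g gi; rewrite (minor_expand g BE).
have F0 (h : {ffun 'I_n -> bool}) :
    0 <= (\prod_i (if h i then be (g i) else al (g i))) *
    minor A (fun i => g i + (nat_of_bool (h i))%:Z).
  apply: mulr_ge0; last exact: minor_shift_ge0.
  by apply: prodr_ge0 => i _; case: ifP.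
split.
  rewrite (bigD1 [ffun=> false]) //= -[leLHS]addr0; apply: lerD; last first.
    by apply: sumr_ge0 => h _.
  rewrite (@eq_minor A A _ g) => [|i j]; last by rewrite ffunE addr0.
  have -> // : \prod_i (if [ffun=> false] i then be (g i) else al (g i)) =
    \prod_i al (g i) by apply: eq_bigr => i _; rewrite ffunE.
rewrite (bigD1 [ffun=> true]) //= -[leLHS]addr0; apply: lerD; last first.
  by apply: sumr_ge0 => h _.
rewrite (@eq_minor A A (fun i => g i + (nat_of_bool ([ffun=> true] i))%:Z)
  (fun i => g i + 1)) => [|i j]; last by rewrite ffunE.
have -> // : \prod_i (if [ffun=> true] i then be (g i) else al (g i)) =
  \prod_i be (g i) by apply: eq_bigr => i _; rewrite ffunE.
Qed.

(** Right multiplication by Psi sums the columns from y upwards. Perform it one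
    column at a time from the top: each stage is a bidiagonal step with al = 1
    and be supported at a single column. *)
Lemma minor_cumulative A B (top : int) :
  (forall y j, B y j = A y j + B (y + 1) j) ->
  (forall y j, top <= y -> A y j = 0 /\ B y j = 0) ->
  minors_ge0 A -> forall g, increasing g -> minor A g <= minor B g.
Proof.
move=> BE top0 A0.
(* The columns from top - m upwards have already been summed. *)
pose D m y := if top - m%:Z <= y then B y else A y.
have D_ok m : minors_ge0 (D m) /\ (forall g, increasing g -> minor A g <= minor (D m) g).
  elim: m => [|m [Dm0 Dm]].
    have E y j : D 0%N y j = A y j.
      by rewrite /D subr0; case: ifP => // /(top0 y j)[-> ->].
    by split=> g gi; rewrite (eq_minor (g' := g) (fun i => E (g i))) //; exact: A0.
  pose be (y : int) : R := if y == top - m.+1%:Z then 1 else 0.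
  have be0 y : 0 <= be y by rewrite /be; case: ifP.
  have DE y j : D m.+1 y j = 1 * D m y j + be y * D m (y + 1) j.
    rewrite mul1r /D /be; have [->|yN] := eqVneq y (top - m.+1%:Z).
      have -> : (top - m%:Z <= top - m.+1%:Z) = false by clear; lia.
      have -> : (top - m%:Z <= top - m.+1%:Z + 1) = true by clear; lia.
      by rewrite lexx mul1r.
    rewrite mul0r addr0.
    by have -> : (top - m.+1%:Z <= y) = (top - m%:Z <= y) by clear -yN; lia.
  have st := minor_step (fun=> ler01) be0 DE Dm0.
  have le g : increasing g -> minor (D m) g <= minor (D m.+1) g.
    by move=> gi; have [+ _] := st g gi; rewrite big1 // mul1r.
  split=> g gi; first by apply: le_trans (le g gi); exact: Dm0.
  by apply: le_trans (le g gi); exact: Dm.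
(* After m stages all columns selected by g have been summed. *)
move=> g gi; pose m := (\sum_(i < n) absz (top - g i)%R)%N.
rewrite (_ : minor B g = minor (D m) g); first by have [_] := D_ok m; apply.
apply: eq_minor => i j; rewrite /D ifT //.
have : (absz (top - g i)%R <= m)%N by rewrite /m (bigD1 i) //= leq_addr.
by clear; lia.
Qed.

(** Either some selected column contains no 1, or the selected columns are
    exactly the n consecutive ones, since the selection is increasing. *)
Lemma minor_id_ge0 c : minors_ge0 (fun y j => (y == c + (nat_of_ord j)%:Z)%:R).
Proof.
move=> g gi.
have [/existsP[i /forallP gN]|] :=
    boolP [exists i, [forall j : 'I_n, g i != c + (nat_of_ord j)%:Z]].
  rewrite /minor (expand_det_row _ i) big1 // => j _.
  by rewrite mxE (negbTE (gN j)) mul0r.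
rewrite negb_exists => /forallP gP.
have {}gP i : exists j : 'I_n, g i = c + (nat_of_ord j)%:Z.
  by have := gP i; rewrite negb_forall => /existsP[j /negPn/eqP]; exists j.
have lo k (kn : (k < n)%N) : c + k%:Z <= g (Ordinal kn).
  elim: k kn => [|k IH] kn; first by have [j ->] := gP (Ordinal kn); clear; lia.
  have kn' := ltnW kn; have := IH kn'; have := gi (Ordinal kn') (Ordinal kn) (ltnSn k).
  by clear; lia.
have hi k (kn : (n - k.+1 < n)%N) : (k < n)%N ->
    g (Ordinal kn) <= c + (n - k.+1)%N%:Z.
  elim: k kn => [|k IH] kn kn0.
    have [j ->] := gP (Ordinal kn); have := ltn_ord j; move: (nat_of_ord j).
    by clear; lia.
  have kn1 : (n - k.+1 < n)%N by clear -kn0; lia.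
  have lt : (Ordinal kn < Ordinal kn1)%N by rewrite /=; clear -kn0; lia.
  have := IH kn1 (ltnW kn0); have := gi _ _ lt; move: (g _) (g _) => u v.
  by clear -kn0; lia.
have gE i : g i = c + (nat_of_ord i)%:Z.
  apply/eqP; rewrite eq_le; apply/andP; split.
    have kE : (n - (n - i.+1).+1 = i)%N by have := ltn_ord i; clear; lia.
    have kn : (n - (n - i.+1).+1 < n)%N by rewrite kE.
    have E : Ordinal kn = i by exact: val_inj.
    have := hi _ kn; rewrite E kE.
    by apply; have := ltn_ord i; clear; lia.
  by have := lo i (ltn_ord i); rewrite (_ : Ordinal _ = i) //; exact: val_inj.
rewrite /minor (_ : \matrix_(i, j) _ = 1%:M) ?det1 //.
apply/matrixP => i j; rewrite !mxE gE (can_eq (addKr _)).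
by congr (_%:R).
Qed.

End Minors.

Section CornerMinor.
Variables (R : realType) (n : nat) (a b : nat -> int -> R) (beta : R).
Hypotheses (beta0 : 0 < beta) (a_ge0 : forall i k, (i < n)%N -> 0 <= a i k).
Hypothesis (b_ge : forall i k, (i < n)%N -> beta <= b i k).

Let col (c : int) (m : nat) (y : int) (j : 'I_n) : R :=
  prodM a b 0 m (c + (nat_of_ord j)%:Z) y.

Lemma zmul_PsiS (A : zmx R) x y : lower_off 0 A ->
  zmul A (Psi R) x y = A x y + zmul A (Psi R) x (y + 1).
Proof.
move=> Al; have [K KP] : exists K : nat, x - 0 < y + 1 + K%:Z.
  by exists (absz (x - y)%R); clear; lia.
have KP' : x - 0 < y + K.+1%:Z by move: KP; clear; lia.
have yP : y <= y + 0 by rewrite addr0.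
have yP' : y + 1 <= y + 1 + 0 by rewrite addr0.
rewrite (zmul_lower_window Al (@lower_off_Psi R) yP KP').
rewrite (zmul_lower_window Al (@lower_off_Psi R) yP' KP).
rewrite /winsum big_nat_recl // addr0 /Psi lexx mulr1; congr (_ + _).
apply: eq_bigr => l _.
have -> : y + l.+1%:Z = y + 1 + l%:Z by clear; lia.
have -> : (y <= y + 1 + l%:Z) = true by clear; lia.
by have -> : (y + 1 <= y + 1 + l%:Z) = true by clear; lia.
Qed.

(** Each bidiagonal factor moves the n selected columns one step to the left at
    the price of n weights b, and each Psi does not decrease the minor. *)
Lemma consecutive_minor_ge c i : (i <= n)%N ->
  minors_ge0 (col c (2 * i)) /\
  beta ^+ (n * i) <= minor (col c (2 * i))
    (fun j => c - i%:Z + (nat_of_ord j)%:Z).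
Proof.
elim: i => [|i IH] ilt.
  have idE y j : col c (2 * 0) y j = (y == c + (nat_of_ord j)%:Z)%:R.
    rewrite /col muln0 /prodM big_geq // /zid /zdiag eq_sym.
    by case: ifP.
  have -> : col c (2 * 0) = fun y j => (y == c + (nat_of_ord j)%:Z)%:R.
    by apply/funext => y; apply/funext => j; exact: idE.
  split; first exact: minor_id_ge0.
  rewrite muln0 expr0 /minor (_ : \matrix_(i, j) _ = 1%:M) ?det1 //.
  apply/matrixP => k j; rewrite !mxE subr0 (can_eq (addKr _)).
  by congr (_%:R).
have [D0 Dge] := IH (ltnW ilt).
pose D1 := col c (2 * i).+1.
have lowP m : lower_off 0 (prodM a b 0 m) by exact: lower_off_prodM.
have D1E y j : D1 y j = a i y * col c (2 * i) y j + b i (y + 1) * col c (2 * i) (y + 1) j.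
  rewrite /D1 /col /prodM zbig_nat_recr //; last by move=> ?; exact: lower_off_transM.
  have -> : transM a b (2 * i) = bidiag (a i) (b i).
    by rewrite /transM mul2n odd_double doubleK.
  by rewrite zmul_bidiagr [a i y * _]mulrC [b i _ * _]mulrC.
have b0 y : 0 <= b i (y + 1) by apply: le_trans (b_ge _ ilt); exact: ltW.
have st := minor_step (fun y => a_ge0 y ilt) b0 D1E D0.
have D10 : minors_ge0 D1.
  move=> g gi; have [+ _] := st g gi; apply: le_trans.
  apply: mulr_ge0; last exact: D0.
  by apply: prodr_ge0 => k _; exact: a_ge0.
have D2E y j : col c (2 * i.+1) y j = D1 y j + col c (2 * i.+1) (y + 1) j.
  have -> : (2 * i.+1 = (2 * i).+2)%N by clear; lia.
  rewrite /D1 /col {1 3}/prodM zbig_nat_recr //; last by move=> ?; exact: lower_off_transM.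
  have -> : transM a b (2 * i).+1 = Psi R by rewrite /transM /= mul2n odd_double.
  exact: (zmul_PsiS _ _ (lowP (2 * i).+1)).
have zero m y (j : 'I_n) : c + n%:Z <= y -> col c m y j = 0.
  move=> cy; apply/eqP; apply: contraTT cy => /(lowP m).
  by have := ltn_ord j; move: (nat_of_ord j); clear; lia.
have cum := minor_cumulative D2E (fun y j cy => conj (zero _ y j cy) (zero _ y j cy)) D10.
split.
  by move=> g gi; apply: le_trans (cum g gi); exact: D10.
set g := fun j : 'I_n => _.
have gi : increasing g.
  by move=> j k; rewrite /g; move: (nat_of_ord j) (nat_of_ord k); clear; lia.
apply: le_trans (cum g gi); have [_ +] := st g gi; apply: le_trans.
rewrite mulnS exprD; apply: ler_pM.
- by rewrite exprn_ge0 // ltW.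
- by rewrite exprn_ge0 // ltW.
- rewrite -[X in beta ^+ X](card_ord n) -prodr_const; apply: ler_prod => k _.
  by rewrite (ltW beta0) b_ge.
- rewrite (@eq_minor _ _ _ (col c (2 * i)) _ (fun j => c - i%:Z + (nat_of_ord j)%:Z)) // => k j.
  by congr col; rewrite /g; move: (nat_of_ord k); clear; lia.
Qed.

Lemma corner_det_ge c :
  beta ^+ (n * n) <= \det (\matrix_(i < n, j < n)
     prodM a b 0 (2 * n) (c + (nat_of_ord i)%:Z) (c - n%:Z + (nat_of_ord j)%:Z)).
Proof.
have [_] := consecutive_minor_ge c (leqnn n); rewrite /minor -det_tr.
by congr (_ <= \det _); apply/matrixP => i j; rewrite !mxE.
Qed.

End CornerMinor.

Section Cramer.
Variables (R : realType).

Lemma det_norm_le k (M : 'M[R]_k) (B : R) : (forall i j, `|M i j| <= B) ->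
  `|\det M| <= \sum_(s : {perm 'I_k}) B ^+ k.
Proof.
move=> MB; apply: le_trans (ler_norm_sum _ _ _) _; apply: ler_sum => s _.
rewrite normrM normrX normrN1 expr1n mul1r normr_prod.
rewrite -[X in B ^+ X](card_ord k) -prodr_const; apply: ler_prod => i _.
by rewrite normr_ge0 MB.
Qed.

(** The entries of the adjugate are minors of M, hence bounded. *)
Lemma cramer_bound n (B dl : R) : 0 <= B -> 0 < dl ->
  exists2 K : R, 0 <= K & forall (M : 'M[R]_n) (z w : 'cV[R]_n) (om : R),
    (forall i j, `|M i j| <= B) -> dl <= \det M -> M *m z = w ->
    (forall i, `|w i 0| <= om) -> forall j, `|z j 0| <= K * om.
Proof.
move=> B0 dl0; pose D := \sum_(s : {perm 'I_n.-1}) B ^+ n.-1.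
have D0 : 0 <= D by apply: sumr_ge0 => s _; exact: exprn_ge0.
exists (n%:R * D / dl); first by rewrite !mulr_ge0 // invr_ge0 ltW.
move=> M z w om MB dlM Mz wom j.
have om0 : 0 <= om by apply: le_trans (wom j); exact: normr_ge0.
rewrite mulrAC ler_pdivlMr // mulrC.
apply: (@le_trans _ _ (`|\det M * z j 0|)).
  by rewrite normrM ler_wpM2r // (le_trans dlM) // ler_norm.
have -> : \det M * z j 0 = (\adj M *m w) j 0.
  by rewrite -Mz mulmxA mul_adj_mx mul_scalar_mx mxE.
rewrite mxE; apply: le_trans (ler_norm_sum _ _ _) _.
apply: (@le_trans _ _ (\sum_(k < n) D * om)).
  apply: ler_sum => k _; rewrite normrM; apply: ler_pM => //.
  rewrite mxE /cofactor normrM normrX normrN1 expr1n mul1r.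
  by apply: det_norm_le => i l; rewrite !mxE.
by rewrite sumr_const card_ord -[_ *+ n]mulr_natl mulrA.
Qed.

End Cramer.

(** * The linear system of a finite window *)

Section Window.
Variables (R : realType) (n : nat) (a b : nat -> int -> R) (rho : R).
Hypotheses (rho0 : 0 < rho) (ab_good : good_weights rho n a b).

Let row (r : nat) : int := n%:Z - r.+1%:Z.
Let P := prodM a b 0 (2 * n).
Let T (r s : nat) : R := P (row r) (- s.+1%:Z).
Let Ups (s l : nat) : R := Upsilon n a b (row s) (row l).

(** Lambda reaches at most n steps down, so the rows at distance more than n
    from the lower end of the window do not see the truncation. *)
Lemma Lambda_window (B : zmx R) y r m : (r + n < m)%N ->
  \sum_(0 <= k < m) Lambda n a b (row r) (row k) * B (row k) y =
  zmul (Lambda n a b) B (row r) y.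
Proof.
move=> rm; have [Ll Lu _] := Lambda_spec rho0 ab_good.
have lo_hi : n%:Z - m%:Z + m%:Z = n%:Z by rewrite subrK.
rewrite /zmul (proj2 (@zsum_finite_support _ _ (n%:Z - m%:Z) m _)) ?(winsum_descending _ lo_hi) //.
move=> k; rewrite mulf_eq0 negb_or => /andP[Lk _].
have := Ll _ _ Lk; have := Lu _ _ Lk; move: rm; rewrite /row; clear; lia.
Qed.

Lemma Upsilon_window q s p : (q < p)%N ->
  \sum_(0 <= r < p) Ups q r * banded_factor n a b (row r) (- s.+1%:Z) = (q == s)%:R.
Proof.
move=> qp; have [Vu Uu _ [_ UI]] := Upsilon_spec rho0 ab_good.
have lo_hi : n%:Z - p%:Z + p%:Z = n%:Z by rewrite subrK.
have UE x : lu_U n a b x (row s) = banded_factor n a b x (- s.+1%:Z).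
  by rewrite /lu_U zmul_shiftr -/(banded_factor n a b) /row addrAC subrr sub0r.
have : zmul (Upsilon n a b) (lu_U n a b) (row q) (row s) = (q == s)%:R.
  rewrite UI /zid /zdiag; have -> : (row q == row s) = (q == s).
    by rewrite /row; clear; lia.
  by case: eqP.
move=> <-; rewrite /zmul (proj2 (@zsum_finite_support _ _ (n%:Z - p%:Z) p _)) ?(winsum_descending _ lo_hi) //.
  by apply: eq_bigr => r _; rewrite UE.
move=> k; rewrite mulf_eq0 negb_or => /andP[/Uu Uk Nk].
have := Vu _ _ Nk; move: qp Uk; rewrite /row; clear; lia.
Qed.

(** On the p upper rows Lambda W is the section of U, which is upper triangular,
    so the same section of Upsilon inverts it. *)
Lemma window_interior (G H y : nat -> R) p :
  (forall r, (r < n + p)%N -> \sum_(0 <= s < n + p) T r s * y s = G r) ->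
  (forall r, (r < p)%N ->
     \sum_(0 <= k < n + p) Lambda n a b (row r) (row k) * G k = H r) ->
  forall q, (q < p)%N -> y q = \sum_(0 <= r < p) Ups q r * H r.
Proof.
move=> TG LG q qp.
have [Vu _ _ _] := Upsilon_spec rho0 ab_good.
have NH r : (r < p)%N ->
    H r = \sum_(0 <= s < p) banded_factor n a b (row r) (- s.+1%:Z) * y s.
  move=> rp; rewrite -LG // big_nat.
  under eq_bigr => k kp do rewrite -TG // mulr_sumr.
  rewrite -big_nat exchange_big /=.
  transitivity (\sum_(0 <= s < n + p) banded_factor n a b (row r) (- s.+1%:Z) * y s).
    apply: eq_bigr => s _; rewrite -(Lambda_prodM rho0 ab_good) -(@Lambda_window _ _ r (n + p)).
      by rewrite mulr_suml; apply: eq_bigr => k _; rewrite mulrA.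
    by rewrite addnC ltn_add2l.
  rewrite (@big_cat_nat _ _ _ p) //=; last exact: leq_addl.
  rewrite [X in _ + X]big1_seq ?addr0 // => s /=; rewrite mem_index_iota => /andP[ps _].
  suff -> : banded_factor n a b (row r) (- s.+1%:Z) = 0 by rewrite mul0r.
  apply/eqP; apply: contraTT rp => Nrs.
  have : lu_U n a b (row r) (row s) != 0.
    by rewrite /lu_U zmul_shiftr -/(banded_factor n a b) /row addrAC subrr sub0r.
  by move=> /Vu; move: ps; rewrite /row; clear; lia.
rewrite big_nat; under eq_bigr => r rp do rewrite NH // mulr_sumr.
rewrite -big_nat exchange_big /=.
under eq_bigr => s _.
  under eq_bigr => r _ do rewrite mulrA.
  rewrite -mulr_suml Upsilon_window //.
  over.
rewrite (@big_cat_nat _ _ _ q) //=; last exact: ltnW.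
rewrite (@big_ltn _ _ _ q) // eqxx mul1r big1_seq ?add0r => [|s /=].
  rewrite big1_seq ?addr0 // => s /=; rewrite mem_index_iota => /andP[qs _].
  by rewrite ltn_eqF ?mul0r.
by rewrite mem_index_iota => /andP[_ sq]; rewrite gtn_eqF ?mul0r.
Qed.

Lemma good_bounds : exists beta M : R, [/\ 0 < beta, 0 < M &
  forall i k, (i < n)%N -> [/\ 0 <= a i k <= M, 0 <= b i k <= M & beta <= b i k]].
Proof.
have [m [M [C [m0 M0 C0 H]]]] := ab_good; exists m, M; split=> // i k ilt.
have [/andP[? ?] /andP[? ?] _] := H i k ilt.
by split=> //; apply/andP; split=> //; [exact: ltW|apply: le_trans (ltW m0) _].
Qed.

(** The n lowest unknowns are controlled, uniformly in p, by the corner block,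
    whose determinant is bounded below and whose entries are bounded. The
    window numbers indices downwards and [corner_det_ge] upwards, whence the
    reversals. *)
Lemma window_corner : exists2 K : R, 0 <= K & forall (y : nat -> R) p om,
  (forall i, (i < n)%N ->
     `|\sum_(0 <= j < n) T (p + i) (p + j) * y (p + j)%N| <= om) ->
  forall j, (j < n)%N -> `|y (p + j)%N| <= K * om.
Proof.
have [beta [M [beta0 M0 bd]]] := good_bounds.
have a0 i k : (i < n)%N -> 0 <= a i k by move=> /bd -/(_ k)[/andP[]].
have bb i k : (i < n)%N -> beta <= b i k by move=> /bd -/(_ k)[].
have ab i k : (i < n)%N -> 0 <= a i k <= M /\ 0 <= b i k <= M.
  by move=> /bd -/(_ k)[].
have [C C0 PC] := exp_bounded_prodM M0 ab 0 (leqnn (2 * n)) (ltr1n R 2).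
have B0 : 0 <= C * 2 ^ (2 * n)%N%:Z by rewrite mulr_ge0 // exprz_ge0.
have [K K0 HK] := @cramer_bound R n _ _ B0 (exprn_gt0 (n * n) beta0).
exists K => // y p om Hom j jn.
pose c : int := - p%:Z.
pose TC := \matrix_(i < n, j < n)
  P (c + (nat_of_ord i)%:Z) (c - n%:Z + (nat_of_ord j)%:Z).
pose z : 'cV[R]_n := \col_j y (p + rev_ord j)%N.
have TCE (i k : 'I_n) : TC (rev_ord i) (rev_ord k) = T (p + i) (p + k).
  rewrite mxE /T /row /c /=; have := ltn_ord i; have := ltn_ord k.
  move: (nat_of_ord i) (nat_of_ord k) => u v vn un.
  by congr P; move: un vn; clear; lia.
have := HK TC z (TC *m z) om _ (corner_det_ge beta0 a0 bb c) (erefl _) _ (rev_ord (Ordinal jn)).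
rewrite mxE rev_ordK; apply.
  move=> i k; rewrite mxE; apply: le_trans (PC _ _) _; rewrite ler_wpM2l //.
  apply: ler_weXz2l; first by rewrite ler1n.
  have := ltn_ord i; have := ltn_ord k.
  by move: (nat_of_ord i) (nat_of_ord k) => u v; rewrite /c; clear; lia.
move=> i; rewrite mxE -(rev_ordK i); set i' := rev_ord i.
rewrite (reindex_inj rev_ord_inj) /=.
under eq_bigr => k _ do rewrite TCE mxE rev_ordK.
by have := Hom i' (ltn_ord i'); rewrite big_mkord.
Qed.

Lemma Wmx_sum p (v : 'cV[R]_(n + p)) (y : nat -> R) :
  (forall s : 'I_(n + p), y s = v s 0) ->
  forall r : 'I_(n + p),
    (Wmx n a b p *m v) r 0 = \sum_(0 <= s < n + p) T r s * y s.
Proof.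
by move=> yv r; rewrite mxE big_mkord; apply: eq_bigr => s _; rewrite mxE yv.
Qed.

Definition extend0 m (v : 'cV[R]_m) (s : nat) : R :=
  if insub s is Some i then v i 0 else 0.

Lemma extend0E m (v : 'cV[R]_m) (i : 'I_m) : extend0 v i = v i 0.
Proof. by rewrite /extend0 valK. Qed.

(** A kernel vector vanishes in the interior of the window, hence at the
    corner too. *)
Lemma Wmx_unit p : Wmx n a b p \in unitmx.
Proof.
have [K K0 HK] := window_corner.
rewrite unitmxE unitfE -det_tr; apply/negP => /det0P[v v0 vW].
have Wv : Wmx n a b p *m v^T = 0 by rewrite -[LHS]trmxK trmx_mul trmxK vW trmx0.
pose y := extend0 v^T.
have yE (s : 'I_(n + p)) : y s = v^T s 0 by exact: extend0E.
have Ty r : (r < n + p)%N -> \sum_(0 <= s < n + p) T r s * y s = 0.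
  by move=> rp; rewrite -(Wmx_sum yE (Ordinal rp)) Wv mxE.
have yin q : (q < p)%N -> y q = 0.
  move=> qp; rewrite (window_interior (H := fun=> 0) Ty _ qp).
    by rewrite big1 // => ? _; rewrite mulr0.
  by move=> r _; rewrite big1 // => ? _; rewrite mulr0.
have ycor j : (j < n)%N -> y (p + j)%N = 0.
  move=> jn; apply/normr0_eq0/le_anti; rewrite normr_ge0 andbT.
  rewrite -(mulr0 K); apply: HK jn => i ilt.
  have ip : (p + i < n + p)%N by rewrite addnC ltn_add2r.
  have := Ty _ ip; rewrite (@big_cat_nat _ _ _ p) ?leq_addl //=.
  rewrite big1_seq ?add0r => [|s /=]; last first.
    by rewrite mem_index_iota => /andP[_ /yin ->]; rewrite mulr0.
  by rewrite sum_tail => ->; rewrite normr0.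
case/negP: v0; apply/eqP/rowP => s; rewrite mxE.
have := yE s; rewrite mxE => <-.
have [/yin //|ps] := ltnP s p.
rewrite -(subnKC ps); apply: ycor.
by rewrite ltn_subLR // (leq_trans (ltn_ord s)) // addnC.
Qed.

End Window.

(** * Passage to the limit *)

Section Series.
Variable R : realType.

(** The half-line series differs from the series over the negative indices by a
    shift and a finite sum. *)
Lemma zsum_half_line (f : int -> R) (N : nat) :
  (forall k, f k != 0 -> k < N%:Z) ->
  cvgn (series (fun s : nat => f (N%:Z - s.+1%:Z))) ->
  zsum_cvg f /\ zsum f = limn (series (fun s : nat => f (N%:Z - s.+1%:Z))).
Proof.
move=> fN cf.
have H1 : \forall m \near \oo, series (fun k : nat => f k%:Z) m = winsum f 0 N.
  near=> m; have mN : (N <= m)%N by near: m; exact: nbhs_infty_ge.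
  rewrite seriesEnat /=.
  under eq_bigr do rewrite -[_%:Z]add0r.
  rewrite -/(winsum f 0 m) -(subnKC mN) winsum_cat add0r.
  rewrite [X in _ + X]big1 ?addr0 // => l _; apply/eqP.
  by apply: contraT => /fN; clear; lia.
have H2 : series (fun k : nat => f (- k.+1%:Z)) @ \oo -->
    limn (series (fun s : nat => f (N%:Z - s.+1%:Z))) - winsum f 0 N.
  have -> : series (fun k : nat => f (- k.+1%:Z)) =
      [sequence series (fun s : nat => f (N%:Z - s.+1%:Z)) (m + N)%N]_m -
      cst (winsum f 0 N).
    apply/funext => m /=; rewrite /GRing.sub_fun /= !seriesEnat /=.
    have -> : \sum_(0 <= k < m) f (- k.+1%:Z) = winsum f (- m%:Z) m.
      by rewrite (winsum_descending f (addNr _)); apply: eq_bigr => k _; rewrite sub0r.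
    have lo : - m%:Z + (m + N)%N%:Z = N%:Z by rewrite PoszD addKr.
    by rewrite fctE /= -(winsum_descending f lo) winsum_cat addNr addrK.
  apply: cvgB; last exact: cvg_cst.
  by rewrite cvg_shiftn.
have c1 : cvgn (series (fun k : nat => f k%:Z)) by exact: is_cvg_near_cst H1.
split; first by split=> //; apply/cvg_ex; eexists; exact: H2.
by rewrite /zsum (lim_near_cst _ H1)// (cvg_lim _ H2)// addrCA subrr addr0.
Unshelve. all: by end_near.
Qed.

Lemma dominated_series (u : nat -> R) (C s : R) : 0 <= s -> s < 1 ->
  (forall k, `|u k| <= C * s ^+ k) -> cvgn (series u).
Proof.
move=> s0 s1 uC; apply: normed_cvg.
apply: (@series_le_cvg _ _ (geometric C s)).
- by move=> k; exact: normr_ge0.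
- by move=> k; exact: le_trans (normr_ge0 _) (uC k).
- by move=> k; exact: uC.
- by apply: is_cvg_geometric_series; rewrite ger0_norm.
Qed.

Lemma cvg_finite_sum L (u : nat -> nat -> R) (v : nat -> R) :
  (forall l, (l < L)%N -> u l @ \oo --> v l) ->
  (fun m => \sum_(0 <= l < L) u l m) @ \oo --> \sum_(0 <= l < L) v l.
Proof.
elim: L => [|L IH] uv.
  under eq_fun do rewrite big_geq //.
  by rewrite big_geq //; exact: cvg_cst.
under eq_fun do rewrite big_nat_recr //=.
rewrite big_nat_recr //=; apply: cvgD; last exact: uv.
by apply: IH => l lL; apply: uv; exact: ltnW.
Qed.

End Series.

Section Limit.
Variables (R : realType) (n : nat) (a b : nat -> int -> R) (rho : R).
Hypotheses (rho0 : 0 < rho) (rho1 : rho < 1) (ab_good : good_weights rho n a b).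
Variables (m1 m2 : nat) (x1 x2 : int).
Hypothesis (x2_ge : -1 <= x2).

Let row (r : nat) : int := n%:Z - r.+1%:Z.
Let P := prodM a b 0 (2 * n).
Let T (r s : nat) : R := P (row r) (- s.+1%:Z).
Let Ups (s l : nat) : R := Upsilon n a b (row s) (row l).
Let alpha (s : nat) : R := prodM a b m1 (2 * n) x1 (- s.+1%:Z).
Let g (r : nat) : R := prodM a b 0 m2 (row r) x2.
Let h (r : nat) : R := zmul (Lambda n a b) (prodM a b 0 m2) (row r) x2.
Let Y (s : nat) : R := \sum_(0 <= l < n.+1) Ups s l * h l.

Lemma g_eq0 r : (n < r)%N -> g r = 0.
Proof.
move=> nr; apply/eqP; apply: contraTT nr => /(@lower_off_prodM R a b 0 m2 _ _).
by move: x2_ge; rewrite /row; clear; lia.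
Qed.

Lemma h_eq0 r : (n < r)%N -> h r = 0.
Proof.
have [Ll _ _] := Lambda_spec rho0 ab_good.
have LP := lower_off0_mul Ll (@lower_off_prodM R a b 0 m2).
move=> nr; apply/eqP; apply: contraTT nr => /LP.
by move: x2_ge; rewrite /row; clear; lia.
Qed.

(** The solution y of W y = g, extended by zero past the end of the window. *)
Definition window_solution p : nat -> R :=
  extend0 (invmx (Wmx n a b p) *m (\col_(r < n + p) g r)).

Lemma corr_kernel_solution p : corr_kernel n a b p m1 x1 m2 x2 =
  - ((m1 < m2)%N%:R * prodM a b m1 m2 x1 x2) +
  \sum_(0 <= s < n + p) alpha s * window_solution p s.
Proof.
rewrite /corr_kernel; congr (_ + _); rewrite exchange_big /= big_mkord.
apply: eq_bigr => s _; rewrite /window_solution extend0E mxE mulr_sumr.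
by apply: eq_bigr => r _; rewrite mxE mulrA.
Qed.

Lemma window_solutionP p r : (r < n + p)%N ->
  \sum_(0 <= s < n + p) T r s * window_solution p s = g r.
Proof.
move=> rp; rewrite -(Wmx_sum a b (extend0E _) (Ordinal rp)).
by rewrite mulKVmx ?mxE //; exact: (Wmx_unit rho0 ab_good).
Qed.

Lemma window_solution_interior p q : (n < p)%N -> (q < p)%N ->
  window_solution p q = Y q.
Proof.
move=> np qp.
rewrite (window_interior rho0 ab_good (H := h) (@window_solutionP p) _ qp).
  rewrite (@big_cat_nat _ _ _ n.+1) //= [X in _ + X]big1_seq ?addr0 // => l /=.
  by rewrite mem_index_iota => /andP[nl _]; rewrite h_eq0 ?mulr0.
by move=> r rp; apply: (Lambda_window rho0 ab_good); rewrite addnC ltn_add2l.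
Qed.

Lemma Upsilon_decay (t : R) : rho < t -> exists2 C : R, 0 <= C &
  forall s l, `|Ups s l| <= C * t ^ (s%:Z - l%:Z).
Proof.
move=> rt; have [_ _ Ue _] := Upsilon_spec rho0 ab_good.
have [C C0 H] := Ue t rt; exists C => // s l.
by have := H (row s) (row l); have -> : row l - row s = s%:Z - l%:Z by rewrite /row; clear; lia.
Qed.

Lemma Y_decay (t : R) : rho < t ->
  exists2 C : R, 0 <= C & forall s, `|Y s| <= C * t ^+ s.
Proof.
move=> rt; have t0 : 0 < t by exact: lt_trans rt.
have [C C0 H] := Upsilon_decay rt.
exists (\sum_(0 <= l < n.+1) C * t ^ (- l%:Z) * `|h l|).
  by apply: sumr_ge0 => l _; rewrite !mulr_ge0 // exprz_ge0 // ltW.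
move=> s; apply: le_trans (ler_norm_sum _ _ _) _; rewrite mulr_suml.
apply: ler_sum => l _; rewrite normrM mulrAC ler_wpM2r //.
by apply: le_trans (H s l) _; rewrite -mulrA exprnP -expfzDr ?gt_eqF // addrC.
Qed.

Lemma alpha_growth (t : R) : 1 < t ->
  exists2 C : R, 0 <= C & forall s, `|alpha s| <= C * t ^+ s.
Proof.
move=> t1; have t0 : 0 < t by exact: lt_trans t1.
have [beta [M [_ M0 bd]]] := good_bounds ab_good.
have ab i k : (i < n)%N -> 0 <= a i k <= M /\ 0 <= b i k <= M.
  by move=> /bd -/(_ k)[].
have [C C0 PC] := exp_bounded_prodM M0 ab m1 (leqnn (2 * n)) t1.
exists (C * t ^ (x1 + 1)) => [|s]; first by rewrite mulr_ge0 // exprz_ge0 // ltW.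
apply: le_trans (PC _ _) _; rewrite -mulrA ler_wpM2l // exprnP -expfzDr ?gt_eqF //.
by have -> : x1 - - s.+1%:Z = x1 + 1 + s%:Z by clear; lia.
Qed.

Lemma sum_pow2_le p : \sum_(0 <= s < p) (2 : R) ^ (s%:Z - p%:Z) <= 1.
Proof.
suff -> : \sum_(0 <= s < p) (2 : R) ^ (s%:Z - p%:Z) = 1 - 2 ^ (- p%:Z).
  by rewrite gerBl exprz_ge0.
elim: p => [|p IH]; first by rewrite big_geq // oppr0 expr0z subrr.
have E z : (2 : R) ^ (z - p.+1%:Z) = 2 ^ (z - p%:Z) / 2.
  rewrite -[2^-1]/(2 ^ (-1)%Z) -expfzDr //.
  by have -> : z - p.+1%:Z = z - p%:Z + -1 by clear; lia.
rewrite big_nat_recr //=; under eq_bigr do rewrite E.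
rewrite -mulr_suml IH !E subrr expr0z -[- p.+1%:Z]sub0r E sub0r.
by move: (2 ^ _) => z; lra.
Qed.

(** The right-hand side of the corner system is a sum of T r s * Y s over s < p
    with Y s = O(t^s). Bounding T with base w = 2/t leaves a geometric sum of
    powers of 2 below 1, so the total is O(t^p). *)
Lemma window_solution_corner (t : R) : rho < t -> t < 1 -> exists2 C : R, 0 <= C &
  forall p j, (n < p)%N -> (j < n)%N ->
    `|window_solution p (p + j)%N| <= C * t ^+ p.
Proof.
move=> rt t1; have t0 : 0 < t by exact: lt_trans rt.
have [K K0 HK] := window_corner ab_good.
have [CY CY0 HY] := Y_decay rt.
have [beta [M [_ M0 bd]]] := good_bounds ab_good.
have ab i k : (i < n)%N -> 0 <= a i k <= M /\ 0 <= b i k <= M.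
  by move=> /bd -/(_ k)[].
pose w := 2 / t.
have w1 : 1 < w by rewrite /w ltr_pdivlMr // mul1r (lt_trans t1) // ltr1n.
have w0 : 0 < w by exact: lt_trans w1.
have [C C0 PC] := exp_bounded_prodM M0 ab 0 (leqnn (2 * n)) w1.
exists (K * (C * CY * w ^+ n)).
  by rewrite !mulr_ge0 // exprn_ge0 // ltW.
move=> p j np jn; rewrite -mulrA; apply: HK jn => i ilt.
have ip : (p + i < n + p)%N by rewrite addnC ltn_add2r.
have := window_solutionP ip; rewrite g_eq0; last exact: leq_trans np (leq_addr _ _).
rewrite (@big_cat_nat _ _ _ p) ?leq_addl //=.
rewrite sum_tail => /eqP; rewrite addr_eq0 => /eqP E.
rewrite -normrN -E {E}; apply: le_trans (ler_norm_sum _ _ _) _.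
apply: (@le_trans _ _ (C * CY * w ^+ n * t ^+ p *
    \sum_(0 <= s < p) (2 : R) ^ (s%:Z - p%:Z))); last first.
  rewrite -[leRHS]mulr1 ler_wpM2l ?sum_pow2_le //.
  by rewrite !mulr_ge0 ?exprn_ge0 // ltW.
rewrite mulr_sumr big_nat [leRHS]big_nat; apply: ler_sum => s /andP[_ sp].
rewrite normrM window_solution_interior //.
apply: (@le_trans _ _ (C * w ^ (n%:Z + (s%:Z - p%:Z)) * (CY * t ^+ s))).
  apply: ler_pM => //; apply: le_trans (PC _ _) _; rewrite ler_wpM2l //.
  apply: ler_weXz2l; first exact: ltW.
  by rewrite /row; clear; lia.
rewrite expfzDr ?gt_eqF // -exprnP.
have -> : w ^ (s%:Z - p%:Z) = 2 ^ (s%:Z - p%:Z) * t ^ (p%:Z - s%:Z).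
  by rewrite /w expfzMl exprz_inv opprB.
have -> : t ^+ p = t ^ (p%:Z - s%:Z) * t ^+ s.
  by rewrite !exprnP -expfzDr ?gt_eqF // subrK.
move: (t ^ _) (2 ^ _) (t ^+ s) (w ^+ n) => u1 u2 u3 u4.
by rewrite le_eqVlt; apply/orP; left; apply/eqP; ring.
Qed.

Let A := zmul (prodM a b m1 (2 * n)) (zshift R (- n%:Z)).
Let term (l : nat) : R := zmul A (Upsilon n a b) x1 (row l) * h l.

Lemma A_row s : A x1 (row s) = alpha s.
Proof. by rewrite /A zmul_shiftr /row /alpha addrAC subrr sub0r. Qed.

(** A growth rate w for alpha and a decay rate t for Y whose product is still
    summable. *)
Lemma decay_rates : exists t w : R, [/\ rho < t, t < 1, 1 < w & w * t < 1].
Proof.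
pose t := (rho + 1) / 2; exists t, (2 / (1 + t)).
have rt : rho < t by rewrite /t; move: rho1; lra.
have t1 : t < 1 by rewrite /t; move: rho1; lra.
have t0 : 0 < t by exact: lt_trans rt.
have d0 : 0 < 1 + t by rewrite addr_gt0.
split=> //; first by rewrite ltr_pdivlMr // mul1r; move: t1; lra.
by rewrite mulrAC ltr_pdivrMr // mul1r; move: t1; lra.
Qed.

(** The sum over k defining the entry of A Upsilon is one-sided because Upsilon
    is upper triangular; counted downwards from n - 1 it is dominated by a
    geometric series. *)
Lemma column_cvg l : zsum_cvg (fun k => A x1 k * Upsilon n a b k (row l)) /\
  series (fun s => alpha s * Ups s l) @ \oo --> zmul A (Upsilon n a b) x1 (row l).
Proof.
have [t [w [rt t1 w1 wt1]]] := decay_rates.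
have t0 : 0 < t by exact: lt_trans rt.
have w0 : 0 < w by exact: lt_trans w1.
have [C C0 HC] := alpha_growth w1; have [D D0 HD] := Upsilon_decay rt.
have [_ Uu _ _] := Upsilon_spec rho0 ab_good.
have c : cvgn (series (fun s => alpha s * Ups s l)).
  apply: (@dominated_series _ _ (C * D * t ^ (- l%:Z)) (w * t)) => // [|s].
    by rewrite mulr_ge0 // ltW.
  rewrite normrM; apply: le_trans (ler_pM _ _ (HC s) (HD s l)) _ => //.
  rewrite expfzDr ?gt_eqF // exprMn -exprnP.
  by rewrite le_eqVlt; apply/orP; left; apply/eqP; ring.
have E : (fun s : nat => A x1 (n%:Z - s.+1%:Z) * Upsilon n a b (n%:Z - s.+1%:Z) (row l)) =
    (fun s => alpha s * Ups s l).
  by apply/funext => s; rewrite -/(row s) A_row.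
have [||Z1 Z2] := @zsum_half_line _ (fun k => A x1 k * Upsilon n a b k (row l)) n.
- move=> k; rewrite mulf_eq0 negb_or => /andP[_ /Uu].
  by rewrite /row; clear; lia.
- by rewrite E.
by split=> //; rewrite /zmul Z2 E; exact: c.
Qed.

(** Only the indices l <= n contribute, since the column x_2 of
    Lambda M_0 ... M_(m_2-1) vanishes in all rows smaller than x_2 >= -1. *)
Lemma term_cvg : series term @ \oo --> \sum_(0 <= l < n.+1) term l.
Proof.
apply: cvg_near_cst; near=> m.
have nm : (n < m)%N by near: m; exact: nbhs_infty_gt.
rewrite seriesEnat /= (@big_cat_nat _ _ _ n.+1) //= [X in _ + X]big1_seq ?addr0 // => l /=.
by rewrite mem_index_iota => /andP[nl _]; rewrite /term h_eq0 ?mulr0.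
Unshelve. all: by end_near.
Qed.

Lemma interior_cvg : series (fun s => alpha s * Y s) @ \oo -->
  \sum_(0 <= l < n.+1) term l.
Proof.
have -> : series (fun s => alpha s * Y s) =
    (fun m => \sum_(0 <= l < n.+1) series (fun s => alpha s * Ups s l) m * h l).
  apply/funext => m; rewrite seriesEnat /=.
  under [RHS]eq_bigr do rewrite seriesEnat /= mulr_suml.
  rewrite exchange_big /=; apply: eq_bigr => s _.
  by rewrite /Y mulr_sumr; apply: eq_bigr => l _; rewrite mulrA.
apply: cvg_finite_sum => l _; apply: cvgMr_tmp.
by have [] := column_cvg l.
Qed.

Lemma corner_cvg :
  (fun p => \sum_(0 <= j < n)
     alpha (p + j)%N * window_solution p (p + j)%N) @ \oo --> (0 : R).
Proof.
have [t [w [rt t1 w1 wt1]]] := decay_rates.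
have t0 : 0 < t by exact: lt_trans rt.
have w0 : 0 < w by exact: lt_trans w1.
have [C C0 HC] := alpha_growth w1; have [D D0 HD] := window_solution_corner rt t1.
pose E := \sum_(0 <= j < n) C * w ^+ j * D.
apply/norm_cvg0P; apply: (@squeeze_cvgr _ _ _ _ (cst 0) (geometric E (w * t))); last 2 first.
- exact: cvg_cst.
- by apply: cvg_geometric; rewrite ger0_norm // mulr_ge0 // ltW.
near=> p; have np : (n < p)%N by near: p; exact: nbhs_infty_gt.
rewrite normr_ge0 /=; apply: le_trans (ler_norm_sum _ _ _) _.
rewrite /E mulr_suml big_nat [leRHS]big_nat; apply: ler_sum => j /andP[_ jn].
rewrite normrM; apply: le_trans (ler_pM _ _ (HC _) (HD p j np jn)) _ => //.
rewrite exprMn exprD.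
by rewrite le_eqVlt; apply/orP; left; apply/eqP; ring.
Unshelve. all: by end_near.
Qed.

Lemma corr_kernel_cvg :
  (fun p : nat => corr_kernel n a b p m1 x1 m2 x2) @ \oo -->
  - ((m1 < m2)%N%:R * prodM a b m1 m2 x1 x2) + limn (series term).
Proof.
rewrite (cvg_lim _ term_cvg) //.
under eq_fun do rewrite corr_kernel_solution.
apply: cvgD; first exact: cvg_cst.
rewrite -[X in _ --> X]addr0.
(* Once p > n, the solution equals Y in the interior; its tail is the corner. *)
have near_eq : \forall p \near \oo,
  series (fun s => alpha s * Y s) p +
  \sum_(0 <= j < n) alpha (p + j)%N * window_solution p (p + j)%N =
  \sum_(0 <= s < n + p) alpha s * window_solution p s.
  near=> p; have np : (n < p)%N by near: p; exact: nbhs_infty_gt.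
  rewrite [RHS](@big_cat_nat _ _ _ p) ?leq_addl //= sum_tail seriesEnat /=.
  congr (_ + _); rewrite big_nat [RHS]big_nat; apply: eq_bigr => s /andP[_ sp].
  by rewrite window_solution_interior.
apply: cvg_trans (cvgD interior_cvg corner_cvg).
exact: near_eq_cvg.
Unshelve. all: by end_near.
Qed.

End Limit.

Theorem theorem6p9 (R : realType) (n : nat) (a b : nat -> int -> R)
    (C rho delta1 delta2 : R)
    (n_ge1 : (1 <= n)%N)
    (a_gt0 : forall (i : nat) (j : int), (i < n)%N -> 0 < a i j)
    (b_gt0 : forall (i : nat) (j : int), (i < n)%N -> 0 < b i j)
    (C_gt0 : 0 < C)
    (rho_gt0 : 0 < rho) (rho_lt1 : rho < 1)
    (delta1_gt0 : 0 < delta1) (delta12 : delta1 < delta2)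
    (ratio_bound : forall (i k : nat), (i < n)%N ->
      (ereal_sup [set ((\prod_(0 <= l < k) a i (j + l%:Z)) /
                       (\prod_(0 <= l < k) b i (j + l%:Z)))%:E
                  | j in [set: int]]
       <= (C * rho ^+ k)%:E)%E)
    (sum_bounds : forall (i : nat) (j : int), (i < n)%N ->
      delta1 <= a i j + b i j <= delta2)
    (m1 m2 : nat) (m1_le : (m1 <= 2 * n)%N) (m2_le : (m2 <= 2 * n)%N)
    (x1 x2 : int) (x1_ge : -1 <= x1) (x2_ge : -1 <= x2) :
  let A := zmul (prodM a b m1 (2 * n)) (zshift R (- n%:Z)) in
  let B := zmul (Lambda n a b) (prodM a b 0 m2) in
  let term (l : nat) : R :=
    zmul A (Upsilon n a b) x1 (n%:Z - l.+1%:Z) * B (n%:Z - l.+1%:Z) x2 in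
  [/\ forall l : nat,
        zsum_cvg (fun k => A x1 k * Upsilon n a b k (n%:Z - l.+1%:Z)),
      cvgn (series term)
    & (fun p : nat => corr_kernel n a b p m1 x1 m2 x2) @ \oo -->
        - ((m1 < m2)%N%:R * prodM a b m1 m2 x1 x2) + limn (series term)].
Proof.
move=> A B term.
have good := good_weights_base a_gt0 b_gt0 C_gt0 rho_gt0 delta1_gt0 delta12
  ratio_bound sum_bounds.
split.
- by move=> l; have [] := column_cvg rho_gt0 rho_lt1 good m1 x1 l.
- exact: (cvgP _ (@term_cvg R n a b rho rho_gt0 good m1 m2 x1 x2 x2_ge)).
- exact: (@corr_kernel_cvg R n a b rho rho_gt0 rho_lt1 good m1 m2 x1 x2 x2_ge).
Qed.
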